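(* Let $D$ be a unital C*-algebra and let $X\in\mathsf{Bim_{fgp}}(D)$ be full and faithful. Let $\mathcal{O}_X$ be the Cuntz–Pimsner algebra of $X$, let $A=\mathcal{O}_X^{\gamma}$ be the fixed-point algebra of its gauge action $\gamma$, and let $E:\mathcal{O}_X\to A$ be the canonical expectation onto the fixed points of the gauge action. Let $F:\mathsf{Hilb_{fd}}(\mathbb{Z})\to\mathsf{Bim_{fgp}}(A)$ be the unitary tensor functor determined by $F(\mathbb{C}_k)={}^{(k)}\mathcal{D}$ for $k\in\mathbb{Z}$ and $F(\lambda\,\mathrm{id}_{\mathbb{C}_k})=\lambda\,\mathrm{id}_{{}^{(k)}\mathcal{D}}$ for $\lambda\in\mathbb{C}$, with tensorator ${}^{(k)}\mathcal{D}\boxtimes_A{}^{(\ell)}\mathcal{D}\to{}^{(k+\ell)}\mathcal{D}$, $T\boxtimes S\mapsto T\circ S$. Then there is an expectation-preserving $*$-isomorphism of C*-discrete inclusions $$\left(A\overset{E}{\subset}\mathcal{O}_X\right)\cong\left(A\overset{E'}{\subset}A\rtimes_{r,F}\mathbb{C}[\mathbb{Z}]\right),$$ where $E'$ is the canonical expectation projecting onto the $0$-graded component.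
   Context: Bimodules. For unital C*-algebras $A,B$, a right C*-correspondence from $A$ to $B$ is a right Hilbert $B$-module (inner product $\langle\cdot\mid\cdot\rangle_B$, linear in the second variable) with a unital $*$-homomorphism from $A$ into the adjointable operators. Left C*-correspondences are defined symmetrically, with inner product ${}_A\langle\cdot,\cdot\rangle$ linear in the first variable. A right C*-correspondence $Y$ lies in $\mathsf{Bim_{fgp}}(A\to B)$ if it can be equipped with a left $A$-valued inner product making it a left C*-correspondence, such that the two inner products induce equivalent norms and $Y$ has a finite right Pimsner–Popa basis $\{u_i\}$ ($\xi=\sum_iu_i\lhd\langle u_i\mid\xi\rangle_B$) and a finite left Pimsner–Popa basis $\{v_j\}$ ($\xi=\sum_j{}_A\langle\xi,v_j\rangle\rhd v_j$). $\mathsf{Bim_{fgp}}(A):=\mathsf{Bim_{fgp}}(A\to A)$; morphisms are adjointable bimodule maps. $X\in\mathsf{Bim_{fgp}}(D)$ is full if $\mathrm{span}\{\langle\eta\mid\xi\rangle_D\}$ is dense in $D$, and faithful if the left action is a unital injective $*$-homomorphism. Cuntz–Pimsner algebra. On the Fock module $\mathcal{F}(X)=\overline{\bigoplus_{n\ge0}X^{\boxtimes_Dn}}$ ($X^{\boxtimes_D0}=D$), let $\varphi_\infty(d)$ be the diagonal left action of $d\in D$ and $\tau_\infty(\xi)$ the creation operator $\zeta\mapsto\xi\boxtimes\zeta$. Let $\varphi,\tau$ be their images in $\mathrm{End}(\mathcal{F}(X)_D)/\mathcal{K}(\mathcal{F}(X)_D)$ (adjointable modulo $D$-compact operators). Then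 $\mathcal{O}_X=C^*(\varphi(D),\tau(X))$, with gauge action $\gamma_z(\varphi(d))=\varphi(d)$, $\gamma_z(\tau(\xi))=z\tau(\xi)$ for $z\in\mathbb{T}$, and $E(x)=\int_{\mathbb{T}}\gamma_z(x)\,d\mu(z)$ with $\mu$ the normalized Haar measure. The bimodules ${}^{(k)}\mathcal{D}$. For $k\in\mathbb{Z}$, $r\ge0$, $k+r\ge0$, let ${}^{k+r}\mathcal{D}^{r}$ be the space of right $D$-linear (automatically adjointable) maps $X^{\boxtimes r}\to X^{\boxtimes(k+r)}$. ${}^{(k)}\mathcal{D}$ is the norm completion of the algebraic inductive limit of these along the isometric maps $T\mapsto T\boxtimes\mathrm{id}_X$. ${}^{(0)}\mathcal{D}$ is a C*-algebra, canonically identified with $A$, and ${}^{(k)}\mathcal{D}$ is an $A$-$A$ bimodule by post- and pre-composition with right inner product $\langle T\mid S\rangle_A=T^*S$. Composition $T\circ S$ of elements of different algebraic limits is defined after tensoring with identities of $X$ on the right, and extended by continuity. C*-discreteness. For a unital inclusion $A\subset B$ with faithful conditional expectation $E:B\to A$, $\mathsf{PQN}(A\subset B)$ is the set of $b\in B$ that lie in some $A$-$A$ sub-bimodule $K\subset B$ which, with right inner product $\langle x\mid y\rangle_A=E(x^*y)$, belongs to $\mathsf{Bim_{fgp}}(A)$. The inclusion is C*-discrete if $\mathsf{PQN}(A\subset B)$ is norm-dense in $B$. An isomorphism of inclusions is expectation-preserving if it restricts to the identification of the copies of $A$ and intertwines the expectations. Crossed product. $\mathsf{Hilb_{fd}}(\mathbb{Z})$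 is the category of finite-dimensional $\mathbb{Z}$-graded Hilbert spaces with simple objects $\mathbb{C}_k$, $\mathbb{C}_k\otimes\mathbb{C}_\ell=\mathbb{C}_{k+\ell}$. $\mathbb{C}[\mathbb{Z}]$ is the group C*-algebra object with $\mathbb{C}[\mathbb{Z}](k)=\mathbb{C}$. The algebraic direct sum $\bigoplus_kF(\mathbb{C}_k)\otimes\mathbb{C}[\mathbb{Z}](k)=\bigoplus_kF(\mathbb{C}_k)$ is a unital $*$-algebra with product given by the tensorator of $F$, and with $\xi^*\in F(\mathbb{C}_{-k})$, for $\xi\in F(\mathbb{C}_k)$, determined by $\xi^*\cdot\eta=\langle\xi\mid\eta\rangle_A$ for $\eta\in F(\mathbb{C}_k)$. $A\rtimes_{r,F}\mathbb{C}[\mathbb{Z}]$ is its completion in the operator norm of left multiplication on the right Hilbert $A$-module direct sum of the $F(\mathbb{C}_k)$. *)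

(* Defs.v *)
(* The scalars are R[i], for R : realType.

   Objects which the theory determines up to a unique isomorphism (interior
   tensor powers, direct sums of Hilbert modules, quotients, generated
   C*-algebras, completions) are given here by the data and the properties which
   pin them down, so that a statement about them covers every realization.  Maps
   between modules or algebras are bare functions; predicates say which are
   linear, adjointable, and so on. *)
From HB Require Import structures.
From mathcomp Require Import all_boot all_order all_algebra complex.
From mathcomp Require Import all_classical all_reals all_analysis.

Set Implicit Arguments.
Unset Strict Implicit.
Unset Printing Implicit Defensive.

Import Order.TTheory GRing.Theory Num.Theory numFieldNormedType.Exports.

Local Open Scope classical_set_scope.
Local Open Scope complex_scope.
Local Open Scope ring_scope.

Reserved Notation "a ** b" (at level 40, left associativity).

(* ** Unital C*-algebras *)

(* The zero algebra is allowed. *)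
Record cstarAlg (R : realType) := CstarAlg {
  ca_car :> completeNormedModType R[i];
  cmul : ca_car -> ca_car -> ca_car;
  cone : ca_car;
  cadj : ca_car -> ca_car;
  cmulA : forall a b c, cmul a (cmul b c) = cmul (cmul a b) c;
  cmul1l : forall a, cmul cone a = a;
  cmul1r : forall a, cmul a cone = a;
  cmul_linl : forall b, linear (fun a => cmul a b);
  cmul_linr : forall a, linear (cmul a);
  cadjK : forall a, cadj (cadj a) = a;
  cadjM : forall a b, cadj (cmul a b) = cmul (cadj b) (cadj a);
  cadj_antilin : forall (k : R[i]) a b,
    cadj (k *: a + b) = k^* *: cadj a + cadj b;
  cnormM : forall a b, `|cmul a b| <= `|a| * `|b|;
  cnorm_cstar : forall a, `|cmul (cadj a) a| = `|a| ^+ 2 }.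

Arguments cone {R _}.
Notation "a ** b" := (cmul a b) : ring_scope.

Definition cpos (R : realType) (A : cstarAlg R) (a : A) : Prop :=
  exists b : A, a = cadj b ** b.

Definition lspan (R : realType) (V : lmodType R[i]) (S : set V) : set V :=
  [set x | exists n (c : 'I_n -> R[i]) (v : 'I_n -> V),
     (forall i, S (v i)) /\ x = \sum_(i < n) c i *: v i].

Definition star_hom (R : realType) (A B : cstarAlg R) (f : A -> B) : Prop :=
  [/\ linear f, forall a b, f (a ** b) = f a ** f b,
      f cone = cone & forall a, f (cadj a) = cadj (f a)].

Definition star_embedding (R : realType) (A B : cstarAlg R) (f : A -> B) : Prop :=
  star_hom f /\ forall a, `|f a| = `|a|.

Definition star_iso (R : realType) (A B : cstarAlg R) (f : A -> B) : Prop :=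
  star_embedding f /\ forall b, exists a, f a = b.

Definition star_closed (R : realType) (A : cstarAlg R) (K : set A) : Prop :=
  [/\ K 0, forall k a b, K a -> K b -> K (k *: a + b),
      forall a b, K a -> K b -> K (a ** b) & forall a, K a -> K (cadj a)].

Definition generated_cstar (R : realType) (A : cstarAlg R) (S : set A) : set A :=
  [set x | forall K : set A, closed K -> star_closed K -> S `<=` K -> K x].

(* ** Right Hilbert modules and right C*-correspondences *)

Record hilbMod (R : realType) (B : cstarAlg R) := HilbMod {
  hm_car :> completeNormedModType R[i];
  ract : hm_car -> B -> hm_car;
  ip : hm_car -> hm_car -> B;
  ract_linl : forall b, linear (fun x => ract x b);
  ract_linr : forall x, linear (ract x);
  ract1 : forall x, ract x cone = x;
  ractM : forall x b c, ract x (b ** c) = ract (ract x b) c;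
  ip_lin : forall x, linear (ip x);
  ip_ract : forall x y b, ip x (ract y b) = ip x y ** b;
  ip_adj : forall x y, ip y x = cadj (ip x y);
  ip_pos : forall x, cpos (ip x x);
  hm_norm : forall x, `|x| ^+ 2 = `|ip x x| }.

Section Operators.
Variables (R : realType) (B : cstarAlg R).
Implicit Types Y Z : hilbMod B.

Definition is_adj Y Z (T : Y -> Z) (T' : Z -> Y) : Prop :=
  forall y z, ip (T y) z = ip y (T' z).

Definition adjointable Y Z (T : Y -> Z) : Prop := exists T', is_adj T T'.

Definition rlinear Y Z (T : Y -> Z) : Prop :=
  linear T /\ forall y b, T (ract y b) = ract (T y) b.

Definition op_bound Y Z (T : Y -> Z) (c : R[i]) : Prop :=
  0 <= c /\ forall y, `|T y| <= c * `|y|.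

Definition is_opnorm Y Z (T : Y -> Z) (c : R[i]) : Prop :=
  op_bound T c /\ forall c', op_bound T c' -> c <= c'.

(* Norm limits of finite sums of the operators z |-> x <y | z>. *)
Definition compact_op Y (T : Y -> Y) : Prop :=
  adjointable T /\
  forall eps : R[i], 0 < eps -> exists n (x y : 'I_n -> Y),
    op_bound (fun z => T z - \sum_(i < n) ract (x i) (ip (y i) z)) eps.

(* Q with the map pi is the quotient of the C*-algebra of adjointable operators
   on Y by the compact ones; pi is unconstrained elsewhere. *)
Record is_adj_mod_compact Y (Q : cstarAlg R) (pi : (Y -> Y) -> Q) : Prop := {
  amc_lin : forall (k : R[i]) (S T : Y -> Y), adjointable S -> adjointable T ->
    pi (fun y => k *: S y + T y) = k *: pi S + pi T;
  amc_mul : forall S T : Y -> Y, adjointable S -> adjointable T ->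
    pi (S \o T) = pi S ** pi T;
  amc_one : pi idfun = cone;
  amc_adj : forall S T : Y -> Y, is_adj S T -> pi T = cadj (pi S);
  amc_surj : forall q, exists2 T : Y -> Y, adjointable T & pi T = q;
  amc_ker : forall T : Y -> Y, adjointable T -> (pi T = 0 <-> compact_op T);
  amc_norm_le : forall (T : Y -> Y) c, adjointable T -> op_bound T c ->
    `|pi T| <= c;
  amc_norm_inf : forall (T : Y -> Y) eps, adjointable T -> 0 < eps ->
    exists2 K : Y -> Y, compact_op K &
      op_bound (fun y => T y + K y) (`|pi T| + eps) }.

Definition is_direct_sum (I : Type) (Y : I -> hilbMod B) (H : hilbMod B)
    (iota : forall i, Y i -> H) : Prop :=
  [/\ forall i, rlinear (iota i),
      forall i x y, ip (iota i x) (iota i y) = ip x y,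
      forall i j x y, i <> j -> ip (iota i x) (iota j y) = 0 &
      dense (lspan [set h | exists i x, h = iota i x])].

End Operators.

Record corr (R : realType) (A B : cstarAlg R) := Corr {
  corr_mod :> hilbMod B;
  lact : A -> corr_mod -> corr_mod;
  lact_linl : forall x, linear (fun a => lact a x);
  lact_linr : forall a, linear (lact a);
  lact1 : forall x, lact cone x = x;
  lactM : forall a b x, lact (a ** b) x = lact a (lact b x);
  lact_ract : forall a x b, lact a (ract x b) = ract (lact a x) b;
  lact_adj : forall a, is_adj (lact a) (lact (cadj a)) }.

Definition corr_iso (R : realType) (A B : cstarAlg R) (Y Z : corr A B)
    (f : Y -> Z) : Prop :=
  [/\ rlinear f, forall a y, f (lact a y) = lact a (f y),
      forall x y, ip (f x) (f y) = ip x y & forall z, exists y, f y = z].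

(* A as a correspondence from A to A. *)
Section TrivialCorr.
Variables (R : realType) (A : cstarAlg R).

Let tip (x y : A) : A := cadj x ** y.

Lemma triv_ip_adj (x y : A) : tip y x = cadj (tip x y).
Proof. by rewrite /tip cadjM cadjK. Qed.

Lemma triv_ip_pos (x : A) : cpos (tip x x).
Proof. by exists x. Qed.

Lemma triv_ip_ract (x y b : A) : tip x (y ** b) = tip x y ** b.
Proof. by rewrite /tip cmulA. Qed.

Lemma triv_norm (x : A) : `|x| ^+ 2 = `|tip x x|.
Proof. by rewrite /tip cnorm_cstar. Qed.

Definition triv_mod : hilbMod A :=
  @HilbMod R A A (@cmul R A) tip (@cmul_linl R A) (@cmul_linr R A)
    (@cmul1r R A) (@cmulA R A) (fun x => cmul_linr (cadj x))
    triv_ip_ract triv_ip_adj triv_ip_pos triv_norm.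

Lemma triv_lactM (a b x : A) : (a ** b) ** x = a ** (b ** x).
Proof. by rewrite cmulA. Qed.

Lemma triv_lact_adj (a : A) :
  @is_adj R A triv_mod triv_mod (cmul a) (cmul (cadj a)).
Proof. by move=> x y; rewrite /= /tip cadjM cmulA. Qed.

Definition triv_corr : corr A A :=
  @Corr R A A triv_mod (@cmul R A) (@cmul_linl R A) (@cmul_linr R A)
    (@cmul1l R A) triv_lactM (@cmulA R A) triv_lact_adj.

End TrivialCorr.

(* lip is the left A-valued inner product.  Completeness and definiteness for
   it follow from the equivalence of the norms. *)
Definition bim_fgp (R : realType) (A B : cstarAlg R) (Y : corr A B) : Prop :=
  exists lip : Y -> Y -> A,
    [/\ (forall y, linear (fun x => lip x y)) /\
        (forall a x y, lip (lact a x) y = a ** lip x y),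
        (forall x y, lip y x = cadj (lip x y)) /\ (forall x, cpos (lip x x)),
        forall x y b, lip (ract x b) y = lip x (ract y (cadj b)),
        exists c : R[i], 0 < c /\
          forall x, `|lip x x| <= c * `|ip x x| /\ `|ip x x| <= c * `|lip x x| &
        (exists n (u : 'I_n -> Y), forall x,
           x = \sum_(i < n) ract (u i) (ip (u i) x)) /\
        (exists n (v : 'I_n -> Y), forall x,
           x = \sum_(j < n) lact (lip x (v j)) (v j))].

Definition full (R : realType) (A B : cstarAlg R) (Y : corr A B) : Prop :=
  dense (lspan [set b : B | exists x y : Y, b = ip x y]).

Definition faithful (R : realType) (A B : cstarAlg R) (Y : corr A B) : Prop :=
  injective (@lact R A B Y).

(* W is the interior tensor product of Y and Z over B, with t y z the elementary
   tensor: t induces a unitary bimodule map from the interior tensor product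
   onto W. *)
Record is_tensor (R : realType) (A B C : cstarAlg R)
    (Y : corr A B) (Z : corr B C) (W : corr A C) (t : Y -> Z -> W) : Prop := {
  tens_linl : forall z, linear (fun y => t y z);
  tens_linr : forall y, linear (t y);
  tens_bal : forall y b z, t (ract y b) z = t y (lact b z);
  tens_lact : forall a y z, t (lact a y) z = lact a (t y z);
  tens_ract : forall y z c, t y (ract z c) = ract (t y z) c;
  tens_ip : forall y z y' z',
    ip (t y z) (t y' z') = ip z (lact (ip y y') z');
  tens_dense : dense (lspan [set w | exists y z, w = t y z]) }.

(* tm p q n is the multiplication of X^p and X^q into X^n.  It is meaningful for
   p + q = n only, and arbitrary otherwise. *)
Record tensor_powers (R : realType) (D : cstarAlg R) (X : corr D D) := {
  tp :> nat -> corr D D;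
  tm : forall p q n, tp p -> tp q -> tp n;
  tp0 : D -> tp 0;
  tp1 : X -> tp 1;
  tp0_iso : @corr_iso R D D (triv_corr D) (tp 0) tp0;
  tp1_iso : corr_iso tp1;
  tm_tensor : forall p q n, (p + q = n)%N -> is_tensor (@tm p q n);
  tmA : forall p q r pq qr n, (p + q = pq)%N -> (q + r = qr)%N ->
    (pq + r = n)%N -> forall x y z,
    @tm pq r n (@tm p q pq x y) z = @tm p qr n x (@tm q r qr y z);
  tm0l : forall n d x, @tm 0 n n (tp0 d) x = lact d x;
  tm0r : forall n x d, @tm n 0 n x (tp0 d) = ract x d }.

Arguments tm {R D X t p q} n.
Arguments tp0 {R D X t}.
Arguments tp1 {R D X t}.

(* ** The Cuntz-Pimsner algebra, its gauge action and expectation *)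

Record cuntz_pimsner (R : realType) (D : cstarAlg R) (X : corr D D)
    (P : tensor_powers X) := {
  fock : hilbMod D;
  fin : forall n, P n -> fock;
  fin_sum : @is_direct_sum R D nat (fun n => P n : hilbMod D) fock fin;
  phi_inf : D -> fock -> fock;
  phi_infP : forall d, adjointable (phi_inf d) /\
    forall n (x : P n), phi_inf d (fin x) = fin (lact d x);
  tau_inf : X -> fock -> fock;
  tau_infP : forall xi, adjointable (tau_inf xi) /\
    forall n (x : P n), tau_inf xi (fin x) = fin (tm n.+1 (tp1 xi) x);
  calkin : cstarAlg R;
  quo : (fock -> fock) -> calkin;
  quoP : is_adj_mod_compact quo;
  ox :> cstarAlg R;
  ox_in : ox -> calkin;
  ox_in_emb : star_embedding ox_in;
  ox_range : range ox_in =
    generated_cstar ([set q | exists d, q = quo (phi_inf d)] `|`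
                     [set q | exists xi, q = quo (tau_inf xi)]);
  phi : D -> ox;
  phiE : forall d, ox_in (phi d) = quo (phi_inf d);
  tau : X -> ox;
  tauE : forall xi, ox_in (tau xi) = quo (tau_inf xi) }.

Arguments fin {R D X P} c {n} _.
Arguments phi {R D X P} c _.
Arguments tau {R D X P} c _.

(* exp (2 pi i t) *)
Definition circ (R : realType) (t : R) : R[i] :=
  cos (2 * pi * t) +i* sin (2 * pi * t).

(* gamma z is meaningful for z on the unit circle only. *)
Record is_gauge (R : realType) (D : cstarAlg R) (X : corr D D)
    (P : tensor_powers X) (O : cuntz_pimsner P) (gamma : R[i] -> O -> O) : Prop := {
  gauge_aut : forall z, `|z| = 1 -> star_iso (gamma z);
  gauge1 : forall x, gamma 1 x = x;
  gaugeM : forall z w x, `|z| = 1 -> `|w| = 1 ->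
    gamma (z * w) x = gamma z (gamma w x);
  gauge_cont : forall x, continuous (fun t : R => gamma (circ t) x);
  gauge_phi : forall z d, `|z| = 1 -> gamma z (phi O d) = phi O d;
  gauge_tau : forall z xi, `|z| = 1 -> gamma z (tau O xi) = z *: tau O xi }.

Definition is_fixed_algebra (R : realType) (O : cstarAlg R)
    (gamma : R[i] -> O -> O) (A : cstarAlg R) (i : A -> O) : Prop :=
  star_embedding i /\
  range i = [set x | forall z, `|z| = 1 -> gamma z x = x].

(* Riemann integral over [0, 1]: the limit over all tagged partitions, in norm. *)
Definition is_riemann_int (R : realType) (V : normedModType R[i])
    (f : R -> V) (v : V) : Prop :=
  forall eps : R, 0 < eps -> exists2 delta : R, 0 < delta &
    forall n (t s : nat -> R), t 0%N = 0 -> t n = 1 ->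
      (forall j, (j < n)%N ->
         [/\ t j <= s j, s j <= t j.+1 & t j.+1 - t j <= delta]) ->
      `|v - \sum_(j < n) (t j.+1 - t j)%:C *: f (s j)| <= eps%:C.

(* For continuous f; the normalized Haar measure of the circle is the image of
   the Lebesgue measure of [0, 1] under circ. *)
Definition is_haar_int (R : realType) (V : normedModType R[i])
    (f : R[i] -> V) (v : V) : Prop :=
  is_riemann_int (fun t : R => f (circ t)) v.

Definition is_gauge_expectation (R : realType) (O A : cstarAlg R)
    (gamma : R[i] -> O -> O) (i : A -> O) (E : O -> A) : Prop :=
  forall x, is_haar_int (fun z => gamma z x) (i (E x)).

(* ** The bimodules of operators between tensor powers of X *)

(* The data below is meaningful for compatible indices only: dj k r s for
   s = k + r, dcomp k l m for m = k + l, dstar k l for l = - k. *)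
Record dbimod (R : realType) (D : cstarAlg R) (X : corr D D)
    (P : tensor_powers X) (O : cuntz_pimsner P) (A : cstarAlg R) (i : A -> O) := {
  dk :> int -> corr A A;
  (* the inclusion of the maps from X^r to X^s into the inductive limit *)
  dj : forall k r s, (P r -> P s) -> dk k;
  dj_lin : forall (k : int) (r s : nat) (a : R[i]) (S T : P r -> P s),
    s%:Z = k + r%:Z -> rlinear S -> rlinear T ->
    @dj k r s (fun x => a *: S x + T x) = a *: @dj k r s S + @dj k r s T;
  dj_norm : forall (k : int) (r s : nat) (T : P r -> P s),
    s%:Z = k + r%:Z -> rlinear T -> is_opnorm T `|@dj k r s T|;
  dj_amp : forall (k : int) (r s : nat) (T : P r -> P s) (T' : P r.+1 -> P s.+1),
    s%:Z = k + r%:Z -> rlinear T -> rlinear T' ->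
    (forall (x : P r) (y : P 1%N),
       T' (tm r.+1 x y) = tm s.+1 (T x) y) ->
    @dj k r.+1 s.+1 T' = @dj k r s T;
  dj_dense : forall k : int,
    dense [set d : dk k | exists r s (T : P r -> P s),
             [/\ s%:Z = k + r%:Z, rlinear T & d = @dj k r s T]];
  dcomp : forall k l m, dk k -> dk l -> dk m;
  dcomp_linl : forall k l m y, k + l = m -> linear (fun x => @dcomp k l m x y);
  dcomp_linr : forall k l m x, k + l = m -> linear (@dcomp k l m x);
  dcomp_norm : forall k l m x y, k + l = m ->
    `|@dcomp k l m x y| <= `|x| * `|y|;
  dcomp_dj : forall (k l m : int) (r s t : nat) (T : P s -> P t) (S : P r -> P s),
    k + l = m -> t%:Z = k + s%:Z -> s%:Z = l + r%:Z -> rlinear T -> rlinear S ->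
    @dcomp k l m (@dj k s t T) (@dj l r s S) = @dj m r t (T \o S);
  dstar : forall k l, dk k -> dk l;
  dstar_antilin : forall (k l : int) (a : R[i]) x y, l = - k ->
    @dstar k l (a *: x + y) = a^* *: @dstar k l x + @dstar k l y;
  dstar_norm : forall (k l : int) x, l = - k -> `|@dstar k l x| = `|x|;
  dstar_dj : forall (k l : int) (r s : nat) (T : P r -> P s) (T' : P s -> P r),
    l = - k -> s%:Z = k + r%:Z -> rlinear T -> is_adj T T' ->
    @dstar k l (@dj k r s T) = @dj l s r T';
  (* the identification of the C*-algebra (0)D with A *)
  did : dk 0 -> A;
  did_lin : linear did;
  did_surj : forall a, exists x, did x = a;
  did_norm : forall x, `|did x| = `|x|;
  did_mul : forall x y, did (@dcomp 0 0 0 x y) = did x ** did y;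
  did_adj : forall x, did (@dstar 0 0 x) = cadj (did x);
  (* T : X^r -> X^r acts on the Fock module by T on the first r legs, and by 0
     on the X^n with n < r *)
  did_dj : forall (r : nat) (T : P r -> P r) (G : fock O -> fock O),
    rlinear T -> adjointable G ->
    (forall n (x : P n), (n < r)%N -> G (fin O x) = 0) ->
    (forall q n (x : P r) (y : P q), (r + q = n)%N ->
       G (fin O (tm n x y)) = fin O (tm n (T x) y)) ->
    ox_in (i (did (@dj 0 r r T))) = quo G;
  dk_lact : forall k a x, lact (did a) x = @dcomp 0 k k a x;
  dk_ract : forall k a x, ract x (did a) = @dcomp k 0 k x a;
  dk_ip : forall k x y,
    ip x y = did (@dcomp (- k) k 0 (@dstar k (- k) x) y) }.

Arguments dj {R D X P O A i} d k {r s} _.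
Arguments dcomp {R D X P O A i d k l} m _ _.
Arguments did {R D X P O A i d}.

(* ** C*-discrete inclusions *)

Definition faithful_expectation (R : realType) (A B : cstarAlg R)
    (i : A -> B) (E : B -> A) : Prop :=
  [/\ linear E, forall a, E (i a) = a,
      forall a b c, E (i a ** b ** i c) = a ** E b ** c,
      forall b, cpos (E (cadj b ** b)) &
      forall b, E (cadj b ** b) = 0 -> b = 0].

(* The sub-bimodule K is the range of f, and Y is K with its inner product. *)
Definition pqn (R : realType) (A B : cstarAlg R)
    (i : A -> B) (E : B -> A) : set B :=
  [set b | exists (Y : corr A A) (f : Y -> B),
     [/\ bim_fgp Y, linear f,
         (forall a y, f (lact a y) = i a ** f y) /\
         (forall a y, f (ract y a) = f y ** i a),
         forall x y, ip x y = E (cadj (f x) ** f y) & range f b]].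

Definition cstar_discrete (R : realType) (A B : cstarAlg R)
    (i : A -> B) (E : B -> A) : Prop :=
  [/\ star_embedding i, faithful_expectation i E & dense (pqn i E)].

(* ** Finite-dimensional Z-graded Hilbert spaces *)

(* The Hilbert space with orthonormal basis the finite set zI, the basis vector v
   being homogeneous of degree zdeg v. *)
Record zhilb := Zhilb { zI : finType; zdeg : zI -> int }.

Definition zsimple (k : int) : zhilb := @Zhilb unit (fun=> k).

Definition ztensor (V W : zhilb) : zhilb :=
  @Zhilb (zI V * zI W)%type (fun x => zdeg x.1 + zdeg x.2).

(* The matrix M stands for the linear map sending v to the sum of the M v w . w. *)
Definition zmat (R : realType) (V W : zhilb) := zI V -> zI W -> R[i].

Section GradedMaps.
Variable R : realType.
Implicit Types U V W : zhilb.

Definition zhom V W (M : zmat R V W) : Prop :=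
  forall v w, M v w != 0 -> zdeg v = zdeg w.

Definition zmat_id V : zmat R V V := fun v w => (v == w)%:R.

Definition zmat_comp U V W (N : zmat R V W) (M : zmat R U V) : zmat R U W :=
  fun u w => \sum_(v : zI V) M u v * N v w.

Definition zmat_adj V W (M : zmat R V W) : zmat R W V := fun w v => (M v w)^*.

Definition zmat_tensor V W V' W' (M : zmat R V V') (N : zmat R W W') :
    zmat R (ztensor V W) (ztensor V' W') :=
  fun x y => M x.1 y.1 * N x.2 y.2.

Definition zmat_assoc U V W :
    zmat R (ztensor (ztensor U V) W) (ztensor U (ztensor V W)) :=
  fun x y => ((x.1.1, (x.1.2, x.2)) == y)%:R.

Definition zmat_unitl V : zmat R (ztensor (zsimple 0) V) V :=
  fun x y => (x.2 == y)%:R.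

Definition zmat_unitr V : zmat R (ztensor V (zsimple 0)) V :=
  fun x y => (x.1 == y)%:R.

(* The identification of C_k (x) C_l with C_m, for m = k + l. *)
Definition zmat_simple (k l m : int) :
    zmat R (ztensor (zsimple k) (zsimple l)) (zsimple m) := fun _ _ => 1.

End GradedMaps.

Arguments zmat_id R V : clear implicits.
Arguments zmat_comp {R U V W} N M.
Arguments zmat_adj {R V W} M.
Arguments zmat_tensor {R V W V' W'} M N.
Arguments zmat_assoc R U V W : clear implicits.
Arguments zmat_unitl R V : clear implicits.
Arguments zmat_unitr R V : clear implicits.
Arguments zmat_simple R k l m : clear implicits.

(* ** Unitary tensor functors from Hilb_fd(Z) to Bim_fgp(A) *)

Record utensor_functor (R : realType) (A : cstarAlg R) := {
  F0 :> zhilb -> corr A A;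
  F0_fgp : forall V, bim_fgp (F0 V);
  F1 : forall V W, zmat R V W -> F0 V -> F0 W;
  F1_rlin : forall V W (M : zmat R V W), zhom M -> rlinear (F1 M);
  F1_lact : forall V W (M : zmat R V W) a x, zhom M ->
    F1 M (lact a x) = lact a (F1 M x);
  F1_adj : forall V W (M : zmat R V W), zhom M -> is_adj (F1 M) (F1 (zmat_adj M));
  F1_id : forall V x, F1 (zmat_id R V) x = x;
  F1_comp : forall U V W (N : zmat R V W) (M : zmat R U V) x,
    zhom N -> zhom M -> F1 (zmat_comp N M) x = F1 N (F1 M x);
  F1_lin : forall V W (c : R[i]) (M N : zmat R V W) x, zhom M -> zhom N ->
    F1 (fun v w => c * M v w + N v w) x = c *: F1 M x + F1 N x;
  (* the tensorator, on elementary tensors *)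
  F2 : forall V W, F0 V -> F0 W -> F0 (ztensor V W);
  F2_tensor : forall V W, is_tensor (@F2 V W);
  F2_nat : forall V W V' W' (M : zmat R V V') (N : zmat R W W') x y,
    zhom M -> zhom N -> F2 (F1 M x) (F1 N y) = F1 (zmat_tensor M N) (F2 x y);
  F2_assoc : forall U V W (x : F0 U) (y : F0 V) (z : F0 W),
    F1 (zmat_assoc R U V W) (F2 (F2 x y) z) = F2 x (F2 y z);
  Fu : A -> F0 (zsimple 0);
  Fu_iso : @corr_iso R A A (triv_corr A) (F0 (zsimple 0)) Fu;
  Fu_l : forall V a (x : F0 V), F1 (zmat_unitl R V) (F2 (Fu a) x) = lact a x;
  Fu_r : forall V a (x : F0 V), F1 (zmat_unitr R V) (F2 x (Fu a)) = ract x a }.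

Arguments F1 {R A} u {V W} _ _.
Arguments F2 {R A} u {V W} _ _.
Arguments Fu {R A} u _.

(* Meaningful for m = k + l. *)
Definition fmul (R : realType) (A : cstarAlg R) (F : utensor_functor A)
    (k l m : int) (x : F (zsimple k)) (y : F (zsimple l)) : F (zsimple m) :=
  F1 F (zmat_simple R k l m) (F2 F x y).

(* F(C_k) is (k)D by means of w k, and the tensorator is the composition.  That
   F (c id) = c id is part of F1_lin and F1_id. *)
Definition functor_determined_by (R : realType) (D : cstarAlg R) (X : corr D D)
    (P : tensor_powers X) (O : cuntz_pimsner P) (A : cstarAlg R) (i : A -> O)
    (Dk : dbimod i) (F : utensor_functor A)
    (w : forall k : int, Dk k -> F (zsimple k)) : Prop :=
  [/\ forall k, corr_iso (w k),
      forall k l m x y, k + l = m ->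
        fmul m (w k x) (w l y) = w m (dcomp m x y) &
      forall x : Dk 0, Fu F (did x) = w 0 x].

(* ** The reduced crossed product by the group algebra object of Z *)

(* The *-algebra of which cp_alg is the completion is the span of the images of
   the cp_in k; cp_rep is left multiplication on the direct sum. *)
Record crossed_product (R : realType) (A : cstarAlg R) (F : utensor_functor A) := {
  cp_mod : hilbMod A;
  cp_sum : forall k, F (zsimple k) -> cp_mod;
  cp_sumP : @is_direct_sum R A int (fun k => F (zsimple k) : hilbMod A)
    cp_mod cp_sum;
  cp_adj : forall k, F (zsimple k) -> F (zsimple (- k));
  cp_adjP : forall k (x y : F (zsimple k)),
    fmul 0 (cp_adj x) y = Fu F (ip x y);
  cp_alg :> cstarAlg R;
  cp_in : forall k, F (zsimple k) -> cp_alg;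
  cp_in_lin : forall k, linear (@cp_in k);
  cp_in_mul : forall k l m x y, k + l = m ->
    @cp_in k x ** @cp_in l y = @cp_in m (fmul m x y);
  cp_in_one : @cp_in 0 (Fu F cone) = cone;
  cp_in_adj : forall k x, cadj (@cp_in k x) = @cp_in (- k) (cp_adj x);
  cp_in_dense : dense (lspan [set c | exists k x, c = @cp_in k x]);
  cp_rep : cp_alg -> cp_mod -> cp_mod;
  cp_rep_lin : forall h, linear (fun c => cp_rep c h);
  cp_rep_mul : forall c d h, cp_rep (c ** d) h = cp_rep c (cp_rep d h);
  cp_rep_one : forall h, cp_rep cone h = h;
  cp_rep_adj : forall c, is_adj (cp_rep c) (cp_rep (cadj c));
  cp_rep_norm : forall c, is_opnorm (cp_rep c) `|c|;
  cp_rep_in : forall k l m (x : F (zsimple k)) (y : F (zsimple l)), k + l = m ->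
    cp_rep (cp_in x) (cp_sum y) = cp_sum (fmul m x y) }.

Arguments cp_in {R A F} _ {k} _.

Definition cp_incl (R : realType) (A : cstarAlg R) (F : utensor_functor A)
    (C : crossed_product F) (a : A) : C := cp_in C (Fu F a).

Definition is_cp_expectation (R : realType) (A : cstarAlg R)
    (F : utensor_functor A) (C : crossed_product F) (E' : C -> A) : Prop :=
  [/\ linear E', continuous E', forall a, E' (cp_incl C a) = a &
      forall (k : int) (x : F (zsimple k)), k <> 0 -> E' (cp_in C x) = 0].

(* Main.v *)
(* Both O_X and the crossed product C are graded over Z: the operators
   T : X^r -> X^(k+r) are finite sums of rank-one maps |x><y|, so they act on the
   Fock module modulo compacts by sums of tau(x) tau(y)^*, which embeds (k)D
   isometrically in O_X as the spectral subspace of degree k; and (k)D maps to C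
   by the functor.  Finite graded sums form the same *-algebra on both sides, so
   it suffices to compare the two C*-norms.  Each coefficient of a sum x is
   bounded by the expectation, so for x of degree at most n either norm is at most
   a constant times n times the other; replacing x by the iterates of x^* x,
   whose degree only doubles while the norm is squared, removes the constant.
   Positivity and faithfulness of E' follow from E'(c) = <Omega, c Omega> for the
   vector Omega of the unit in degree 0; finite graded sums form the bimodule
   F(V) with V a finite graded space with one basis vector per degree, whence
   discreteness, and everything is carried to O_X by the isomorphism. *)
Require Import Defs.
From mathcomp Require Import all_boot all_order all_algebra complex.
From mathcomp Require Import all_classical all_reals all_analysis.
From mathcomp Require Import ring lra.

Set Implicit Arguments.
Unset Strict Implicit.
Unset Printing Implicit Defensive.

Import Order.TTheory GRing.Theory Num.Theory numFieldNormedType.Exports.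

Local Open Scope classical_set_scope.
Local Open Scope complex_scope.
Local Open Scope ring_scope.

(** The estimates avoid functional calculus and the order of positive elements; inner products
    satisfy Cauchy-Schwarz only up to a constant. Bounds are obtained up to a factor and sharpened
    by squaring, which is why [graded_rep] asks the maps of both algebras for a uniform bound and
    not for isometry, and why one argument compares the norms in both directions.

    On the side of $\mathcal{O}_X$ the obstacle is that $T$ and $T\otimes\mathrm{id}_X$ have
    different Fock operators: on $X^r$ one acts as $T$, the other as 0. They agree only modulo
    compacts, and $(k)D$ is moreover a completion. Elements are therefore first related to elements
    of $\mathcal{O}_X$; a map appears only by extending a linear isometric relation. Degree $k$ is
    tied to $\mathcal{O}_X$ through products $o^*o$ of degree 0.

    On the side of the crossed product, $A$ is known to embed isometrically only after the
    comparison with $\mathcal{O}_X$, whose representation of the $(k)D$ also serves to identify the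
    adjoint. *)

(** * Inequalities sharpened by repeated squaring *)

(** If $b<a$, the powers of the ratio $1+d=a/b$ outgrow the linear factor $c\,2^j$. *)
Lemma le_of_sqr_tower (R : realType) (a b c : R) : 0 <= a -> 0 <= b -> 0 <= c ->
  (forall j, a ^+ (2 ^ j) <= c * (2 ^ j)%:R * b ^+ (2 ^ j)) -> a <= b.
Proof.
move=> a0 b0 c0 h; rewrite leNgt; apply/negP => ba.
have [bz|bn] := eqVneq b 0.
  by have := h 0%N; rewrite expn0 !expr1 bz mulr0 leNgt -{1}bz ba.
have bp : 0 < b by rewrite lt_neqAle eq_sym bn.
pose d := a / b - 1.
have d0 : 0 < d by rewrite subr_gt0 ltr_pdivlMr // mul1r.
have ab : a = b * (1 + d) by rewrite /d addrC subrK mulrC divfK.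
have hd j : (1 + d) ^+ (2 ^ j) <= c * (2 ^ j)%:R.
  have := h j; rewrite {1}ab exprMn mulrC ler_pM2r //; exact: exprn_gt0.
have bernoulli (M : nat) : 1 + M%:R * d <= (1 + d) ^+ M.
  elim: M => [|M IH]; first by rewrite mul0r addr0 expr0.
  rewrite exprS; apply: le_trans (ler_wpM2l _ IH); last by rewrite addr_ge0 // ltW.
  rewrite -natr1; have : 0 <= M%:R :> R by [].
  by move: d0; nra.
(* Bernoulli's inequality alone is linear in $M=2^j$, so it is squared: $(Md)^2<(1+d)^{2M}\le 2cM$
   would force $M<2c/d^2$. *)
pose x := 2 * c / d ^+ 2.
have x0 : 0 <= x by rewrite /x divr_ge0 ?mulr_ge0 ?exprn_ge0 // ltW.
pose j := Num.bound x.
have jx : x < (2 ^ j)%:R.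
  have /= := archi_boundP x0; move/lt_trans; apply.
  by rewrite ltr_nat ltn_expl.
have := hd j.+1; rewrite expnS mulnC exprM.
have M0 : 0 < (2 ^ j)%:R :> R by rewrite ltr0n expn_gt0.
have b1 := bernoulli (2 ^ j)%N.
have cx : x * d ^+ 2 = 2 * c by rewrite divfK // expf_neq0 // gt_eqF.
have b2 : ((2 ^ j)%:R * d) ^+ 2 < ((1 + d) ^+ (2 ^ j)) ^+ 2.
  have Md : 0 < (2 ^ j)%:R * d by rewrite mulr_gt0.
  by rewrite ltrXn2r ?nnegrE //; move: b1 Md; lra.
rewrite natrM; move: b2; rewrite exprMn expr2.
have : x * d ^+ 2 < (2 ^ j)%:R * d ^+ 2 by rewrite ltr_pM2r // exprn_gt0.
rewrite cx; move: M0; nra.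
Qed.

Lemma ge0_realC (R : realType) (a : R[i]) : 0 <= a ->
  exists2 x : R, 0 <= x & a = x%:C.
Proof.
case: a => x y; rewrite lecE /= => /andP[/eqP -> x0].
by exists x.
Qed.

Lemma le_of_sqr_towerC (R : realType) (a b c : R[i]) :
  0 <= a -> 0 <= b -> 0 <= c ->
  (forall j, a ^+ (2 ^ j) <= c * (2 ^ j)%:R * b ^+ (2 ^ j)) -> a <= b.
Proof.
move=> /ge0_realC[x x0 ->] /ge0_realC[y y0 ->] /ge0_realC[z z0 ->] h.
rewrite lecR; apply: (@le_of_sqr_tower _ _ _ z) => // j.
have := h j; rewrite -(rmorph_nat (real_complex R)) -!rmorphXn -!rmorphM.
by rewrite lecR.
Qed.

(** * Bounded additive maps and isometric extension *)

Section Normed.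
Variables (R : realType).
Implicit Types U V W : normedModType R[i].

(* Additive rather than linear: the adjoint, and the inner product in its first
   variable, are conjugate-linear. *)
Definition badd V W (f : V -> W) : Prop :=
  (forall x y, f (x - y) = f x - f y) /\
  exists2 K : R[i], 0 <= K & forall x, `|f x| <= K * `|x|.

Lemma norm_le_eq0 V (x : V) : (forall e : R[i], 0 < e -> `|x| <= e) -> x = 0.
Proof.
move=> h; apply/normr0_eq0/eqP; rewrite -[_ == _]negbK; apply/negP => n0.
have p : 0 < `|x| by rewrite lt_neqAle eq_sym n0 normr_ge0.
have := h _ (divr_gt0 p (ltr0Sn _ 1)).
rewrite ler_pdivlMr ?ltr0Sn // -subr_le0 mulr_natr mulr2n addrK.
by move=> /(lt_le_trans p); rewrite ltxx.
Qed.

Lemma dense_normP V (S : set V) :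
  dense S <-> forall (x : V) (e : R[i]), 0 < e -> exists2 y, S y & `|x - y| <= e.
Proof.
split=> [dS x e e0|h O [x Ox] oO].
  have [y [By Sy]] := dS (ball x e)° (ex_intro _ x (nbhsx_ballx x e e0)) (open_interior _).
  exists y => //; apply: ltW; move/interior_subset: By.
  by rewrite -ball_normE.
have /nbhs_ballP [e e0 sb] : nbhs x O by apply: open_nbhs_nbhs.
have [y Sy xy] := h x (e / 2) (divr_gt0 e0 (ltr0Sn _ 1)).
exists y; split=> //; apply: sb; rewrite -ball_normE /ball_ /=.
apply: le_lt_trans xy _; rewrite ltr_pdivrMr ?ltr0Sn // ltr_pMr //.
by rewrite ltr1n.
Qed.

Lemma badd0 V W (f : V -> W) : badd f -> f 0 = 0.
Proof. by case=> h _; rewrite -(subrr 0) h subrr. Qed.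

Lemma baddN V W (f : V -> W) x : badd f -> f (- x) = - f x.
Proof. by move=> bf; case: (bf) => h _; rewrite -sub0r h (badd0 bf) sub0r. Qed.

Lemma baddD V W (f : V -> W) x y : badd f -> f (x + y) = f x + f y.
Proof.
by move=> bf; rewrite -{1}[y]opprK; case: (bf) => h _; rewrite h (baddN _ bf) opprK.
Qed.

Lemma badd_sum V W (f : V -> W) (I : finType) (v : I -> V) : badd f ->
  f (\sum_j v j) = \sum_j f (v j).
Proof.
move=> bf; elim/big_rec2: _ => [|j y x _ <-]; first exact: badd0.
exact: baddD.
Qed.

Lemma badd_comp U V W (f : V -> W) (g : U -> V) :
  badd f -> badd g -> badd (f \o g).
Proof.
move=> [fB [K K0 fK]] [gB [L L0 gL]]; split=> [x y|]; first by rewrite /= gB fB.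
exists (K * L); first exact: mulr_ge0.
by move=> x /=; apply: le_trans (fK _) _; rewrite -mulrA ler_wpM2l.
Qed.

Lemma badd_sub V W (f g : V -> W) :
  badd f -> badd g -> badd (fun x => f x - g x).
Proof.
move=> [fB [K K0 fK]] [gB [L L0 gL]]; split=> [x y|].
  by rewrite fB gB !opprD addrACA.
exists (K + L); first exact: addr_ge0.
by move=> x; rewrite mulrDl (le_trans (ler_normB _ _)) // lerD.
Qed.

Lemma badd_add V W (f g : V -> W) :
  badd f -> badd g -> badd (fun x => f x + g x).
Proof.
move=> [fB [K K0 fK]] [gB [L L0 gL]]; split=> [x y|].
  by rewrite fB gB opprD addrACA.
exists (K + L); first exact: addr_ge0.
by move=> x; rewrite mulrDl (le_trans (ler_normD _ _)) // lerD.
Qed.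

Lemma badd_cst0 V W : badd (fun _ : V => 0 : W).
Proof.
by split=> [x y|]; [rewrite subrr|exists 0 => // x; rewrite normr0 mul0r].
Qed.

Lemma badd_bigsum V W (I : finType) (f : I -> V -> W) :
  (forall j, badd (f j)) -> badd (fun x => \sum_j f j x).
Proof.
move=> bf; elim: (index_enum I) => [|j s IH].
  by have <- : (fun _ => 0) = (fun x => \sum_(j <- [::]) f j x)
    by [apply/funext => x; rewrite big_nil]; exact: badd_cst0.
have -> : (fun x => \sum_(j <- j :: s) f j x) =
    (fun x => f j x + \sum_(j <- s) f j x).
  by apply/funext => x; rewrite big_cons.
exact: badd_add.
Qed.

Lemma badd_id V : badd (@idfun V).
Proof. by split=> //; exists 1 => // x; rewrite mul1r. Qed.

Lemma badd_eq0_dense V W (f : V -> W) (S : set V) :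
  badd f -> dense S -> (forall x, S x -> f x = 0) -> forall x, f x = 0.
Proof.
move=> [fB [K K0 fK]] /dense_normP dS f0 x; apply: norm_le_eq0 => e e0.
(* [K] may be 0, so the division is by [K + 1]. *)
have K1 : 0 < K + 1 by rewrite (lt_le_trans ltr01) // lerDr.
have [y Sy xy] := dS x (e / (K + 1)) (divr_gt0 e0 K1).
rewrite -[f x]subr0 -(f0 _ Sy) -fB (le_trans (fK _)) //.
rewrite (le_trans (ler_wpM2l K0 xy)) // mulrCA ler_piMr ?(ltW e0) //.
by rewrite ler_pdivrMr // mul1r lerDl.
Qed.

Lemma badd_eq_dense V W (f g : V -> W) (S : set V) :
  badd f -> badd g -> dense S -> (forall x, S x -> f x = g x) -> f =1 g.
Proof.
move=> bf bg dS fg x; apply/eqP; rewrite -subr_eq0; apply/eqP.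
by apply: (badd_eq0_dense (badd_sub bf bg) dS) => y /fg ->; rewrite subrr.
Qed.

(** Values on [S] alone do not determine an additive map on the complex span, and conjugate-linear
    maps occur; hence the scalars in the hypothesis. *)
Lemma badd_eq_span V W (f g : V -> W) (S : set V) :
  badd f -> badd g -> dense (lspan S) ->
  (forall (c : R[i]) x, S x -> f (c *: x) = g (c *: x)) -> f =1 g.
Proof.
move=> bf bg dS fg; apply: (badd_eq_dense bf bg dS) => _ [n [c [v [Sv ->]]]].
by rewrite !badd_sum //; apply: eq_bigr => j _; apply: fg.
Qed.

(** The bound that makes [f] continuous may be worse than [K]; it only serves to pass to the
    limit. *)
Lemma badd_le_dense V W (f : V -> W) (S : set V) (K : R[i]) : badd f -> 0 <= K ->
  dense S -> (forall x, S x -> `|f x| <= K * `|x|) -> forall x, `|f x| <= K * `|x|.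
Proof.
move=> [fB [L L0 fL]] K0 /dense_normP dS h x; apply/ler_addgt0Pr => e e0.
have M0 : 0 < K + L + 1 by rewrite ltr_wpDl // addr_ge0.
have [y Sy xy] := dS x _ (divr_gt0 e0 M0).
have -> : f x = f y + f (x - y) by rewrite fB addrC subrK.
rewrite (le_trans (ler_normD _ _)) // (le_trans (lerD (h _ Sy) (fL _))) //.
have ny : `|y| <= `|x| + `|x - y| by rewrite -{1}(subKr x y) ler_normB.
apply: le_trans (lerD (ler_wpM2l K0 ny) (lexx _)) _.
rewrite mulrDr -addrA lerD2l -mulrDl.
apply: le_trans (ler_wpM2l (addr_ge0 K0 L0) xy) _.
by rewrite mulrCA ler_piMr ?(ltW e0) // ler_pdivrMr // mul1r lerDl.
Qed.

Lemma linear_sub V W (f : V -> W) : linear f -> forall x y, f (x - y) = f x - f y.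
Proof.
by move=> lf x y; rewrite addrC -scaleN1r lf scaleN1r addrC.
Qed.

Lemma linear_zero V W (f : V -> W) : linear f -> f 0 = 0.
Proof. by move=> lf; rewrite -(subrr 0) (linear_sub lf) subrr. Qed.

Lemma linear_add V W (f : V -> W) x y : linear f -> f (x + y) = f x + f y.
Proof. by move=> lf; rewrite -[x]scale1r lf !scale1r. Qed.

Lemma linear_scale V W (f : V -> W) k x : linear f -> f (k *: x) = k *: f x.
Proof. by move=> lf; rewrite -[k *: x]addr0 lf (linear_zero lf) addr0. Qed.

Lemma linear_bigsum V W (f : V -> W) (I : finType) (v : I -> V) : linear f ->
  f (\sum_j v j) = \sum_j f (v j).
Proof.
move=> lf; elim/big_rec2: _ => [|j y x _ <-]; first exact: linear_zero.
exact: linear_add.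
Qed.

Lemma badd_lin V W (f : V -> W) (K : R[i]) : linear f -> 0 <= K ->
  (forall x, `|f x| <= K * `|x|) -> badd f.
Proof. by move=> lf K0 fK; split; [exact: linear_sub|exists K]. Qed.

Lemma badd_iso V W (f : V -> W) : linear f -> (forall x, `|f x| = `|x|) -> badd f.
Proof. by move=> lf h; apply: (@badd_lin _ _ _ 1) => // x; rewrite mul1r h. Qed.

(** [is_cp_expectation] provides topological continuity only; a ball around 0 on which [f] is at
    most 1 in norm gives the bound. *)
Lemma badd_continuous V W (f : V -> W) : linear f -> continuous f -> badd f.
Proof.
move=> lf cf.
have /cvgrPdist_le /(_ 1 ltr01) := cf 0.
move/nbhs_ballP => [e e0 he].
have he2 : 0 < e / 2 by apply: divr_gt0.
apply: (@badd_lin _ _ _ (e / 2)^-1) => //; first by rewrite invr_ge0 ltW.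
move=> x; have [->|x0] := eqVneq x 0; first by rewrite linear_zero // !normr0 mulr0.
have nx : 0 < `|x| by rewrite normr_gt0.
have := he ((e / 2 / `|x|) *: x); rewrite -ball_normE /ball_ /= sub0r normrN normrZ.
rewrite gtr0_norm ?divr_gt0 // divfK ?gt_eqF // ltr_pdivrMr // ltr_pMr // ltr1n => /(_ isT).
rewrite linear_zero // sub0r normrN linear_scale // normrZ gtr0_norm ?divr_gt0 //.
rewrite -ler_pdivlMl ?divr_gt0 // mulr1 => /le_trans; apply.
by rewrite invf_div mulrC.
Qed.

Lemma cauchy_limit (V : completeNormedModType R[i]) (u : nat -> V) :
  (forall e : R[i], 0 < e -> exists N, forall n m, (N <= n)%N -> (N <= m)%N ->
     `|u n - u m| <= e) ->
  exists l, forall e : R[i], 0 < e -> exists N, forall n, (N <= n)%N ->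
     `|l - u n| <= e.
Proof.
move=> h.
have /cauchy_cvgP cu : cauchy (u @ \oo).
  apply/cauchyP => e e0.
  have [N hN] := h (e / 2) (divr_gt0 e0 (ltr0Sn _ 1)).
  exists (u N); exists N => // n /= Nn; rewrite -ball_normE /ball_ /=.
  apply: le_lt_trans (hN _ _ (leqnn _) Nn) _.
  by rewrite ltr_pdivrMr ?ltr0Sn // ltr_pMr // ltr1n.
exists (lim (u @ \oo)) => e e0.
have /cvgrPdist_le /(_ e e0) [N _ hN] := cu.
by exists N => n Nn; apply: hN.
Qed.

(** The partial map is given as a relation, since its instances are not known beforehand to be
    single-valued; linearity and isometry imply that they are. *)
Lemma isometry_extension (V : normedModType R[i]) (W : completeNormedModType R[i])
    (G : V -> W -> Prop) :
  (forall k v w v' w', G v w -> G v' w' -> G (k *: v + v') (k *: w + w')) ->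
  (forall v w, G v w -> `|w| = `|v|) ->
  dense [set v | exists w, G v w] ->
  exists f : V -> W, [/\ linear f, forall v, `|f v| = `|v| &
    forall v w, G v w -> f v = w].
Proof.
move=> Glin Giso /dense_normP Gd.
have GB v w v' w' : G v w -> G v' w' -> `|w - w'| = `|v - v'|.
  move=> g g'; apply: Giso.
  by rewrite (addrC w) (addrC v) -(scaleN1r w') -(scaleN1r v'); apply: Glin.
(* The closure of the graph: density and completeness of [W] make it total, isometry makes it
   single-valued. *)
pose Gb v w := forall e : R[i], 0 < e ->
    exists v' w', [/\ G v' w', `|v - v'| <= e & `|w - w'| <= e].
have Gb_lin k v w v' w' : Gb v w -> Gb v' w' -> Gb (k *: v + v') (k *: w + w').
  move=> g g' e e0.
  have K0 : 0 < `|k| + 1 by rewrite ltr_wpDl.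
  have d0 := divr_gt0 e0 K0.
  have [a [b [g1 h1 h2]]] := g _ d0.
  have [a' [b' [g1' h1' h2']]] := g' _ d0.
  have sp (Z : normedModType R[i]) (x x' y y' : Z) :
      `|x - y| <= e / (`|k| + 1) -> `|x' - y'| <= e / (`|k| + 1) ->
      `|k *: x + x' - (k *: y + y')| <= e.
    move=> l l'; rewrite opprD addrACA -scalerBr (le_trans (ler_normD _ _)) // normrZ.
    apply: le_trans (lerD (ler_wpM2l (normr_ge0 k) l) l') _.
    by rewrite -{2}[e / _]mul1r -mulrDl mulrC divfK // gt_eqF.
  by exists (k *: a + a'), (k *: b + b'); split; [exact: Glin|exact: sp|exact: sp].
have Gb_iso v w : Gb v w -> `|w| = `|v|.
  have sp (Z : normedModType R[i]) (x y : Z) (d : R[i]) :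
      `|x - y| <= d -> `|x| <= `|y| + d.
    by move=> l; rewrite -{1}(subrK y x) (le_trans (ler_normD _ _)) // addrC lerD2l.
  move=> g; apply/eqP; rewrite eq_le; apply/andP.
  split; apply/ler_addgt0Pr => e e0;
    have [a [b [/Giso g1 h1 h2]]] := g _ (divr_gt0 e0 (ltr0Sn _ 1));
    rewrite [e]splitr addrA.
    apply: le_trans (sp _ _ _ _ h2) _; rewrite lerD2r g1 sp //.
    by rewrite distrC.
  apply: le_trans (sp _ _ _ _ h1) _; rewrite lerD2r -g1 sp //.
  by rewrite distrC.
have Gsub v w : G v w -> Gb v w.
  by move=> g e e0; exists v, w; rewrite !subrr !normr0 ltW.
have Gb_fun v w w' : Gb v w -> Gb v w' -> w = w'.
  move=> g g'; have := Gb_lin (-1) _ _ _ _ g g'.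
  rewrite !scaleN1r addNr => /Gb_iso; rewrite normr0 => /normr0_eq0 /eqP.
  by rewrite addrC subr_eq0 => /eqP.
have Gc v : exists w, Gb v w.
  have /choice[u hu] : forall n : nat, exists p : V * W,
      G p.1 p.2 /\ `|v - p.1| <= n.+1%:R^-1.
    move=> n; have n0 : 0 < n.+1%:R^-1 :> R[i] by rewrite invr_gt0 ltr0Sn.
    by have [v' [w' g] l] := Gd v _ n0; exists (v', w').
  have small (e : R[i]) : 0 < e -> exists N : nat, forall n, (N <= n)%N ->
      n.+1%:R^-1 <= e.
    move=> e0; have [x x0 ex] := ge0_realC (ltW e0).
    have xp : 0 < x by rewrite -ltcR -ex.
    exists (Num.bound x^-1) => n Nn; rewrite invf_ple ?posrE ?ltr0Sn //.
    rewrite ex -rmorphV ?unitfE ?gt_eqF // -(rmorph_nat (real_complex R)) lecR.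
    apply: le_trans (ltW (archi_boundP _)) _; first by rewrite invr_ge0.
    by rewrite ler_nat (leq_trans Nn).
  have [l hl] : exists l, forall e : R[i], 0 < e -> exists N, forall n, (N <= n)%N ->
     `|l - (u n).2| <= e.
    apply: cauchy_limit => e e0.
    have [N hN] := small (e / 2) (divr_gt0 e0 (ltr0Sn _ 1)).
    exists N => n m Nn Nm; rewrite (GB _ _ _ _ (hu n).1 (hu m).1).
    rewrite -[(u n).1](subrK v) -addrA (le_trans (ler_normD _ _)) //.
    rewrite distrC [leRHS](splitr e) lerD // (le_trans (hu _).2) //; exact: hN.
  exists l => e e0.
  have [N hN] := small e e0; have [M hM] := hl e e0.
  exists (u (maxn N M)).1, (u (maxn N M)).2; split.
  - exact: (hu _).1.
  - by apply: le_trans (hu _).2 _; apply: hN; rewrite leq_maxl.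
  - by apply: hM; rewrite leq_maxr.
have /choice[f hf] := Gc.
exists f; split=> [k v v'|v|v w /Gsub g]; last exact: Gb_fun g.
  by apply: Gb_fun (Gb_lin _ _ _ _ _ _ _).
exact: Gb_iso.
Qed.

End Normed.

(** * C*-algebras and Hilbert modules *)

Section CStar.
Variables (R : realType).
Implicit Types A B : cstarAlg R.

Lemma badd_cmull A (a : A) : badd (fun b => a ** b).
Proof. exact: badd_lin (cmul_linr a) (normr_ge0 a) (cnormM a). Qed.

Lemma badd_cmulr A (a : A) : badd (fun b => b ** a).
Proof.
apply: badd_lin (cmul_linl a) (normr_ge0 a) _ => b.
by rewrite mulrC cnormM.
Qed.

Lemma cnorm_adj_le A (a : A) : `|a| <= `|cadj a|.
Proof.
have [->|a0] := eqVneq a 0; first by rewrite normr0.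
have p : 0 < `|a| by rewrite normr_gt0.
by rewrite -(ler_pM2r p) -expr2 -cnorm_cstar cnormM.
Qed.

Lemma cnorm_adj A (a : A) : `|cadj a| = `|a|.
Proof.
by apply/eqP; rewrite eq_le cnorm_adj_le andbT -{2}[a]cadjK cnorm_adj_le.
Qed.

Lemma cadjB A (a b : A) : cadj (a - b) = cadj a - cadj b.
Proof.
by rewrite -(addrC (- b)) -scaleN1r cadj_antilin rmorphN1 scaleN1r addrC.
Qed.

Lemma badd_cadj A : badd (@cadj R A).
Proof.
split=> [x y|]; first exact: cadjB.
by exists 1 => // x; rewrite mul1r cnorm_adj.
Qed.

Lemma cadjZ A k (a : A) : cadj (k *: a) = k^* *: cadj a.
Proof. by rewrite -[k *: a]addr0 cadj_antilin (badd0 (badd_cadj A)) addr0. Qed.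

Lemma cadj1 A : cadj cone = cone :> A.
Proof. by rewrite -[LHS]cmul1r -{2}[cone]cadjK -cadjM cmul1r cadjK. Qed.

Lemma norm_iter_sq A (a : A) j :
  `|iter j (fun z => cadj z ** z) a| = `|a| ^+ (2 ^ j).
Proof.
elim: j => [|j IH]; first by rewrite expr1.
by rewrite iterS cnorm_cstar IH -exprM expnSr.
Qed.

(* A bound on the norm growing linearly in the degree n is improved to 1 by
   passing to the powers of x^* x, because of the C*-identity. *)
Lemma norm_le_of_graded_bound A B (G : nat -> A -> B -> Prop) (K : R[i]) :
  0 <= K ->
  (forall n a b, G n a b -> G (n + n)%N (cadj a ** a) (cadj b ** b)) ->
  (forall n a b, G n a b -> `|a| <= K * n%:R * `|b|) ->
  forall n a b, G n a b -> `|a| <= `|b|.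
Proof.
move=> K0 GM Gle n a b g.
have h j : G (2 ^ j * n)%N (iter j (fun z => cadj z ** z) a)
    (iter j (fun z => cadj z ** z) b).
  elim: j => [|j IH]; first by rewrite mul1n.
  by rewrite !iterS expnS -mulnA mul2n -addnn; apply: GM.
apply: (@le_of_sqr_towerC R _ _ (K * n%:R)) => //; first exact: mulr_ge0.
move=> j; rewrite -!norm_iter_sq (le_trans (Gle _ _ _ (h j))) //.
by rewrite natrM [(2 ^ j)%:R * _]mulrC mulrA.
Qed.

End CStar.

Section HilbertModules.
Variables (R : realType) (B : cstarAlg R).
Implicit Types Y Z : hilbMod B.

Lemma ipBr Y (x y z : Y) : ip x (y - z) = ip x y - ip x z.
Proof. exact: linear_sub (ip_lin x) y z. Qed.

Lemma ipZr Y (x y : Y) k : ip x (k *: y) = k *: ip x y.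
Proof. exact: linear_scale (ip_lin x). Qed.

Lemma ipDr Y (x y z : Y) : ip x (y + z) = ip x y + ip x z.
Proof. exact: linear_add (ip_lin x). Qed.

Lemma ip0r Y (x : Y) : ip x 0 = 0.
Proof. exact: linear_zero (ip_lin x). Qed.

Lemma ipBl Y (x y z : Y) : ip (x - y) z = ip x z - ip y z.
Proof. by rewrite ip_adj ipBr cadjB -!ip_adj. Qed.

Lemma ipZl Y (x y : Y) k : ip (k *: x) y = k^* *: ip x y.
Proof. by rewrite ip_adj ipZr cadjZ -ip_adj. Qed.

Lemma ipDl Y (x y z : Y) : ip (x + y) z = ip x z + ip y z.
Proof. by rewrite ip_adj ipDr (baddD _ _ (badd_cadj B)) -!ip_adj. Qed.

Lemma ip0l Y (x : Y) : ip 0 x = 0.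
Proof. by rewrite ip_adj ip0r (badd0 (badd_cadj B)). Qed.

Lemma ip_suml Y (I : finType) (v : I -> Y) y :
  ip (\sum_j v j) y = \sum_j ip (v j) y.
Proof.
elim/big_rec2: _ => [|j y1 y2 _ <-]; [exact: ip0l|exact: ipDl].
Qed.

Lemma ip_sumr Y (I : finType) (v : I -> Y) y :
  ip y (\sum_j v j) = \sum_j ip y (v j).
Proof. exact: linear_bigsum (ip_lin y). Qed.

Lemma ip_ractl Y (x y : Y) b : ip (ract x b) y = cadj b ** ip x y.
Proof. by rewrite ip_adj ip_ract cadjM -ip_adj. Qed.

Lemma ip_eq0 Y (x : Y) : ip x x = 0 -> x = 0.
Proof.
move=> h; apply: normr0_eq0; apply/eqP; rewrite -sqrf_eq0; apply/eqP.
by rewrite hm_norm h normr0.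
Qed.

Lemma ip_ext Y (x y : Y) : (forall z, ip z x = ip z y) -> x = y.
Proof.
move=> h; apply/eqP; rewrite -subr_eq0; apply/eqP/ip_eq0.
by rewrite ipBr h subrr.
Qed.

(* The polarization identity and the triangle inequality for the norm of Y give
   a Cauchy-Schwarz inequality without any order argument; the constant does not
   matter. *)
Lemma ip_bound1 Y (x y : Y) : `|ip x y| *+ 2 <= ((`|x| + `|y|) ^+ 2 + `|x| ^+ 2 + `|y| ^+ 2) *+ 2.
Proof.
pose s (x y : Y) := ip x y + ip y x.
have sE u v : s u v = ip (u + v) (u + v) - ip u u - ip v v.
  rewrite !ipDr !ipDl /s addrA (addrAC _ (ip v v)) addrK -(addrA (ip u u)).
  by rewrite (addrC (ip u u)) addrK addrC.
have sn u v : `|s u v| <= (`|u| + `|v|) ^+ 2 + `|u| ^+ 2 + `|v| ^+ 2.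
  rewrite sE (le_trans (ler_normB _ _)) // -(hm_norm v) lerD2r.
  rewrite (le_trans (ler_normB _ _)) // -(hm_norm u) lerD2r -hm_norm.
  by rewrite ler_sqr ?nnegrE ?addr_ge0 // ler_normD.
have e : ip x y *+ 2 = s x y - 'i *: s x ('i *: y).
  rewrite /s ipZr ipZl conjCi scalerDr !scalerA -expr2 sqrCi mulrN -expr2 sqrCi.
  by rewrite opprK scale1r scaleN1r opprD opprK addrACA subrr addr0 mulr2n.
rewrite -normrMn e [leRHS]mulr2n (le_trans (ler_normB _ _)) // lerD //.
rewrite normrZ normCi mul1r (le_trans (sn _ _)) // normrZ normCi mul1r //.
Qed.

(** The constant is $(1+1)^2+1+1$, the value of the preceding bound at unit vectors; the general
    case follows by scaling. *)
Lemma ip_bound Y (x y : Y) : `|ip x y| <= 6%:R * `|x| * `|y|.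
Proof.
have [->|x0] := eqVneq x 0; first by rewrite ip0l !normr0 mulr0 mul0r.
have [->|y0] := eqVneq y 0; first by rewrite ip0r !normr0 mulr0.
have nx : 0 < `|x| by rewrite normr_gt0.
have ny : 0 < `|y| by rewrite normr_gt0.
have := ip_bound1 (`|x|^-1 *: x) (`|y|^-1 *: y).
rewrite !normrZ !gtr0_norm ?invr_gt0 // !mulVf ?gt_eqF // expr1n.
rewrite ipZr ipZl conj_Creal ?realV ?normr_real // scalerA normrZ.
rewrite gtr0_norm ?mulr_gt0 ?invr_gt0 // lerMn2r /= -invfM mulrC.
rewrite ler_pdivrMr ?mulr_gt0 // => /le_trans; apply.
rewrite [`|y| * _]mulrC -mulrA; apply: ler_wpM2r; first exact: mulr_ge0.
by rewrite -[1 + 1]/(2%:R) -natrX !natr1 ler_nat.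
Qed.

Lemma badd_ipr Y (x : Y) : badd (ip x).
Proof.
by apply: badd_lin (ip_lin x) _ (fun y => ip_bound x y); apply: mulr_ge0.
Qed.

Lemma badd_ipl Y (x : Y) : badd (fun y => ip y x).
Proof.
split=> [u v|]; first exact: ipBl.
exists (6%:R * `|x|); first exact: mulr_ge0.
by move=> y; rewrite mulrAC ip_bound.
Qed.

Lemma norm_ract Y (x : Y) b : `|ract x b| <= `|b| * `|x|.
Proof.
rewrite -ler_sqr ?nnegrE ?mulr_ge0 // hm_norm ip_ract ip_ractl.
rewrite (le_trans (cnormM _ _)) // exprMn hm_norm mulrC expr2 -mulrA ler_wpM2l //.
by rewrite (le_trans (cnormM _ _)) // cnorm_adj.
Qed.

Lemma badd_ractr Y (x : Y) : badd (ract x).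
Proof.
apply: badd_lin (ract_linr x) (normr_ge0 x) _ => b.
by rewrite mulrC norm_ract.
Qed.

Lemma is_adj_sym Y Z (T : Y -> Z) T' : is_adj T T' -> is_adj T' T.
Proof. by move=> h z y; rewrite ip_adj -h -ip_adj. Qed.

Lemma is_adj_comp (Y Z W : hilbMod B) (S : Z -> W) S' (T : Y -> Z) T' :
  is_adj S S' -> is_adj T T' -> is_adj (S \o T) (T' \o S').
Proof. by move=> hS hT y w; rewrite /= hS hT. Qed.

Lemma adj_rlinear Y Z (T : Y -> Z) : adjointable T -> rlinear T.
Proof.
move=> [T' h]; split=> [k x y|y b]; apply: ip_ext => z.
  by rewrite -(is_adj_sym h) !ipDr !ipZr !(is_adj_sym h).
by rewrite -(is_adj_sym h) !ip_ract (is_adj_sym h).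
Qed.

(* Boundedness of adjointable maps is not needed: the inner product is jointly
   separating and continuous. *)
Lemma adjointable_eq_span Y Z (T S : Y -> Z) (U : set Y) :
  adjointable T -> adjointable S -> dense (lspan U) ->
  (forall (c : R[i]) x, U x -> T (c *: x) = S (c *: x)) -> T =1 S.
Proof.
move=> [T' hT] [S' hS] dU h y; apply: ip_ext => z.
have e : (fun u => ip u (T' z)) =1 (fun u => ip u (S' z)).
  apply: badd_eq_span dU _; try exact: badd_ipl.
  by move=> c x Ux; rewrite -hT -hS h.
by rewrite ip_adj hT (e y) -hS -ip_adj.
Qed.

End HilbertModules.

(** * Finite bases and interior tensor products *)

Section FiniteBases.
Variables (R : realType).

(** Indexed by an arbitrary finite type, so that the basis of a tensor product can be indexed by a
    product type. *)
Definition rbasis (B : cstarAlg R) (Y : hilbMod B) : Prop :=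
  exists (I : finType) (u : I -> Y), forall x, x = \sum_j ract (u j) (ip (u j) x).

Definition rank1 (B : cstarAlg R) (Y Z : hilbMod B) (a : Z) (b x : Y) : Z :=
  ract a (ip b x).

Definition finrank (B : cstarAlg R) (Y Z : hilbMod B) (I : finType)
  (a : I -> Z) (b : I -> Y) (x : Y) : Z := \sum_j rank1 (a j) (b j) x.

Variables (A B : cstarAlg R).

Lemma finrank_adj (Y Z : hilbMod B) (I : finType) (a : I -> Z) (b : I -> Y) :
  is_adj (finrank a b) (finrank b a).
Proof.
move=> y z; rewrite /finrank ip_suml ip_sumr; apply: eq_bigr => j _.
by rewrite /rank1 ip_ractl ip_ract -ip_adj.
Qed.

Lemma finrank_rlinear (Y Z : hilbMod B) (I : finType) (a : I -> Z) (b : I -> Y) :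
  rlinear (finrank a b).
Proof. by apply: adj_rlinear; exists (finrank b a); apply: finrank_adj. Qed.

Lemma rlinear0 (Y Z : hilbMod B) (T : Y -> Z) : rlinear T -> T 0 = 0.
Proof. by case=> /linear_zero. Qed.

Lemma rlinear_sum (Y Z : hilbMod B) (T : Y -> Z) (I : finType) (v : I -> Y) :
  rlinear T -> T (\sum_j v j) = \sum_j T (v j).
Proof. by case=> /linear_bigsum ->. Qed.

Lemma rlinear_comp (Y Z W : hilbMod B) (S : Z -> W) (T : Y -> Z) :
  rlinear S -> rlinear T -> rlinear (S \o T).
Proof.
move=> [lS rS] [lT rT]; split=> [k x y|y b] /=; first by rewrite lT lS.
by rewrite rT rS.
Qed.

Lemma rlinear_lin (Y Z : hilbMod B) (S T : Y -> Z) k :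
  rlinear S -> rlinear T -> rlinear (fun x => k *: S x + T x).
Proof.
move=> [lS rS] [lT rT]; split=> [c x y|y b].
  rewrite lS lT !scalerDr !scalerA [k * c]mulrC -!addrA; congr (_ + _).
  by rewrite addrCA.
by rewrite rS rT (linear_add _ _ (ract_linl b)) (linear_scale _ _ (ract_linl b)).
Qed.

(** Applying [T] to the basis expansion gives $T=\sum_j|Tu_j\rangle\langle u_j|$. Right linear maps
    thereby become adjointable, and expressible by creation operators. *)
Lemma rlinear_finrank (Y Z : hilbMod B) (I : finType) (u : I -> Y) (T : Y -> Z) :
  (forall x, x = \sum_j ract (u j) (ip (u j) x)) -> rlinear T ->
  T = finrank (T \o u) u.
Proof.
move=> hu rT; apply/funext => x; rewrite {1}[x]hu (rlinear_sum _ rT).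
by apply: eq_bigr => j _; case: rT => _ ->.
Qed.

Lemma isometry_norm (Y Z : hilbMod B) (f : Y -> Z) :
  (forall x y, ip (f x) (f y) = ip x y) -> forall x, `|f x| = `|x|.
Proof.
move=> h x; apply/eqP; rewrite -(@eqrXn2 _ 2) //; apply/eqP.
by rewrite !hm_norm h.
Qed.

Lemma dense_ip_ext (Y : hilbMod B) (U : set Y) (x y : Y) :
  dense (lspan U) -> (forall (c : R[i]) z, U z -> ip (c *: z) x = ip (c *: z) y) ->
  x = y.
Proof.
move=> dU h; apply: ip_ext; apply: badd_eq_span dU h; exact: badd_ipl.
Qed.

Lemma rbasis_iso (Y Z : corr A B) (f : Y -> Z) :
  corr_iso f -> rbasis Y -> rbasis Z.
Proof.
move=> [rf _ fip fs] [I [u hu]]; exists I, (f \o u) => z.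
have [y <-] := fs z; rewrite {1}[y]hu (rlinear_sum _ rf).
by apply: eq_bigr => j _; rewrite /= fip; case: rf => _ ->.
Qed.

Lemma rbasis_triv : rbasis (triv_corr B).
Proof.
exists unit, (fun=> cone) => x; rewrite big_const card_unit /= addr0.
by rewrite cadj1 !cmul1l.
Qed.

End FiniteBases.

Section Tensors.
Variables (R : realType) (A B C : cstarAlg R).
Variables (Y : corr A B) (Z : corr B C) (W : corr A C) (t : Y -> Z -> W).
Hypothesis tP : is_tensor t.

Lemma tens_suml (I : finType) (v : I -> Y) z : t (\sum_j v j) z = \sum_j t (v j) z.
Proof. exact: linear_bigsum (tens_linl tP z). Qed.

Lemma tens_sumr (I : finType) (v : I -> Z) y : t y (\sum_j v j) = \sum_j t y (v j).
Proof. exact: linear_bigsum (tens_linr tP y). Qed.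

Lemma tens_ext (x y : W) :
  (forall a b, ip (t a b) x = ip (t a b) y) -> x = y.
Proof.
move=> h; apply: (dense_ip_ext (tens_dense tP)) => c _ [a [b ->]].
by rewrite -(linear_scale _ _ (tens_linl tP b)).
Qed.

(** On $y\otimes z$ the sum over the $v_j$ rebuilds $\langle u_i|y\rangle z$; once the coefficient
    is moved across the tensor sign, the sum over the $u_i$ rebuilds $y$. *)
Lemma tens_basis (I J : finType) (u : I -> Y) (v : J -> Z) :
  (forall x, x = \sum_j ract (u j) (ip (u j) x)) ->
  (forall x, x = \sum_j ract (v j) (ip (v j) x)) ->
  forall x, x = \sum_(p : I * J) ract (t (u p.1) (v p.2)) (ip (t (u p.1) (v p.2)) x).
Proof.
move=> hu hv.
apply: (badd_eq_span (badd_id _) _ (tens_dense tP)).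
  apply: badd_bigsum => p.
  exact: badd_comp (badd_ractr _) (badd_ipr _).
move=> c _ [y [z ->]] /=; rewrite -(linear_scale _ _ (tens_linl tP z)).
move: (c *: y) => {c}y; rewrite {1}[y]hu tens_suml.
rewrite -(pair_bigA _ (fun i j => ract (t (u i) (v j)) (ip (t (u i) (v j)) (t y z)))) /=.
apply: eq_bigr => i _; rewrite (tens_bal tP) {1}[lact _ z]hv tens_sumr.
by apply: eq_bigr => j _; rewrite (tens_ract tP) (tens_ip tP).
Qed.

Lemma rbasis_tensor : rbasis Y -> rbasis Z -> rbasis W.
Proof.
move=> [I [u hu]] [J [v hv]].
by exists (I * J)%type, (fun p => t (u p.1) (v p.2)); apply: tens_basis.
Qed.

(** The basis expansion shows that the algebraic tensor product is already complete, so right linear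
    maps can be compared on elementary tensors. *)
Lemma tensor_sum : rbasis Y -> rbasis Z -> forall x : W,
  exists (I : finType) (y : I -> Y) (z : I -> Z), x = \sum_p t (y p) (z p).
Proof.
move=> [I [u hu]] [J [v hv]] x.
exists (I * J)%type, (fun p => u p.1),
  (fun p => ract (v p.2) (ip (t (u p.1) (v p.2)) x)).
rewrite {1}[x](tens_basis hu hv); apply: eq_bigr => p _.
by rewrite (tens_ract tP).
Qed.

(** $T\otimes\mathrm{id}$ is written on the product basis: right linearity is then immediate, and no
    formula on elementary tensors has to be shown well defined. *)
Lemma tensor_map (Y' : corr A B) (W' : corr A C) (t' : Y' -> Z -> W') (T : Y -> Y') :
  is_tensor t' -> rbasis Y -> rbasis Z -> rlinear T ->
  exists T' : W -> W', rlinear T' /\ forall y z, T' (t y z) = t' (T y) z.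
Proof.
move=> tP' [I [u hu]] [J [v hv]] rT.
exists (finrank (fun p : I * J => t' (T (u p.1)) (v p.2)) (fun p => t (u p.1) (v p.2))).
split=> [|y z]; first exact: finrank_rlinear.
rewrite {2}[y]hu (rlinear_sum _ rT) (linear_bigsum _ (tens_linl tP' z)).
rewrite /finrank -(pair_bigA _ (fun i j => rank1 (t' (T (u i)) (v j)) (t (u i) (v j)) (t y z))) /=.
apply: eq_bigr => i _; case: rT => _ ->; rewrite (tens_bal tP') {1}[lact _ z]hv.
rewrite (linear_bigsum _ (tens_linr tP' _)).
by apply: eq_bigr => j _; rewrite (tens_ract tP') /rank1 (tens_ip tP).
Qed.

End Tensors.

Lemma rbasis_tp (R : realType) (D : cstarAlg R) (X : corr D D)
  (P : tensor_powers X) : rbasis X -> forall n, rbasis (P n).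
Proof.
move=> bX; elim=> [|n IH]; first exact: rbasis_iso (tp0_iso P) (rbasis_triv _).
apply: (rbasis_tensor (@tm_tensor _ _ _ P 1 n n.+1 (add1n n))) IH.
exact: rbasis_iso (tp1_iso P) bX.
Qed.

(** * Operators on the Fock module *)

Section Fock.
Variables (R : realType) (D : cstarAlg R) (X : corr D D) (P : tensor_powers X).
Variables (O : cuntz_pimsner P) (gamma : R[i] -> O -> O).
Hypotheses (gammaP : is_gauge gamma) (bX : rbasis X).

Local Notation quoO := (@quo _ _ _ _ O).
Local Notation phi_infO := (@phi_inf _ _ _ _ O).
Local Notation tau_infO := (@tau_inf _ _ _ _ O).

Let bP := rbasis_tp P bX.
Let tmP p q n (e : (p + q = n)%N) : is_tensor (@tm _ _ _ P p q n) := tm_tensor P e.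

Lemma fin_ip n (x y : P n) : ip (fin O x) (fin O y) = ip x y.
Proof. by have [_ h _ _] := fin_sum O; apply: h. Qed.

Lemma fin_orth n m (x : P n) (y : P m) : n <> m -> ip (fin O x) (fin O y) = 0.
Proof. by have [_ _ h _] := fin_sum O; apply: h. Qed.

Lemma fin_rlinear n : rlinear (@fin _ _ _ _ O n).
Proof. by have [h _ _ _] := fin_sum O; apply: h. Qed.

Lemma fin_sum_big n (I : finType) (v : I -> P n) :
  fin O (\sum_j v j) = \sum_j fin O (v j).
Proof. exact: rlinear_sum (fin_rlinear n). Qed.

Lemma fin_dense : dense (lspan [set h | exists n (x : P n), h = fin O x]).
Proof. by have [_ _ _ h] := fin_sum O. Qed.

Lemma finZ n c (x : P n) : c *: fin O x = fin O (c *: x).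
Proof. by rewrite (linear_scale _ _ (proj1 (fin_rlinear n))). Qed.

Lemma fock_ext (x y : fock O) :
  (forall n (v : P n), ip (fin O v) x = ip (fin O v) y) -> x = y.
Proof.
move=> h; apply: (dense_ip_ext fin_dense) => c _ [n [v ->]].
by rewrite finZ.
Qed.

Lemma ox_inP : star_hom (@ox_in _ _ _ _ O).
Proof. by have [] := ox_in_emb O. Qed.

Lemma ox_in_norm (x : O) : `|ox_in x| = `|x|.
Proof. by have [_] := ox_in_emb O. Qed.

Lemma ox_in_lin : linear (@ox_in _ _ _ _ O).
Proof. by have [] := ox_inP. Qed.

Lemma ox_inM (x y : O) : ox_in (x ** y) = ox_in x ** ox_in y.
Proof. by have [] := ox_inP. Qed.

Lemma ox_in_cadj (x : O) : ox_in (cadj x) = cadj (ox_in x).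
Proof. by have [] := ox_inP. Qed.

Lemma ox_in_inj (x y : O) : ox_in x = ox_in y -> x = y.
Proof.
move=> h; apply/eqP; rewrite -subr_eq0 -normr_eq0 -ox_in_norm (linear_sub ox_in_lin).
by rewrite h subrr normr0.
Qed.

Lemma gauge_lin z : `|z| = 1 -> linear (gamma z).
Proof. by move=> /(gauge_aut gammaP) [[[]]]. Qed.

Lemma gauge_mul z (x y : O) : `|z| = 1 -> gamma z (x ** y) = gamma z x ** gamma z y.
Proof. by move=> /(gauge_aut gammaP) [[[]]]. Qed.

Lemma gauge_cadj z (x : O) : `|z| = 1 -> gamma z (cadj x) = cadj (gamma z x).
Proof. by move=> /(gauge_aut gammaP) [[[]]]. Qed.

Lemma gauge_norm z (x : O) : `|z| = 1 -> `|gamma z x| = `|x|.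
Proof. by move=> /(gauge_aut gammaP) [[]]. Qed.

(* G is the operator of an element of O on which the gauge action acts by chi. *)
Definition homog (chi : R[i] -> R[i]) (G : fock O -> fock O) : Prop :=
  adjointable G /\
  exists o : O, ox_in o = quoO G /\ forall z, `|z| = 1 -> gamma z o = chi z *: o.

Lemma adjointable0 : adjointable (fun _ : fock O => 0 : fock O).
Proof. by exists (fun=> 0) => y z; rewrite ip0l ip0r. Qed.

Lemma adjointableD (S T : fock O -> fock O) :
  adjointable S -> adjointable T -> adjointable (fun h => S h + T h).
Proof.
move=> [S' hS] [T' hT]; exists (fun h => S' h + T' h) => x y.
by rewrite ipDl ipDr hS hT.
Qed.

Lemma quoD (S T : fock O -> fock O) :
  adjointable S -> adjointable T -> quoO (fun h => S h + T h) = quoO S + quoO T.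
Proof.
move=> aS aT; rewrite -[quoO S]scale1r -(amc_lin (quoP O)) //.
by congr (quoO); apply/funext => h; rewrite scale1r.
Qed.

Lemma quo0 : quoO (fun=> 0) = 0.
Proof.
have := quoD adjointable0 adjointable0.
have -> : (fun h : fock O => (0 : fock O) + 0) = fun=> 0 by apply/funext => h; rewrite addr0.
by move/eqP; rewrite -subr_eq0 opprD addrA subrr add0r oppr_eq0 => /eqP.
Qed.

Lemma homog_sum chi (I : finType) (G : I -> fock O -> fock O) :
  (forall j, homog chi (G j)) -> homog chi (fun h => \sum_j G j h).
Proof.
move=> hG; elim: (index_enum I) => [|j s [aS [ o [oS ho]]]].
  have -> : (fun h : fock O => \sum_(j <- [::]) G j h) = fun=> 0.
    by apply/funext => h; rewrite big_nil.
  split; first exact: adjointable0.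
  exists 0; rewrite quo0 (linear_zero ox_in_lin); split=> // z z1.
  by rewrite (linear_zero (gauge_lin z1)) scaler0.
have [aG [p [pG hp]]] := hG j.
have -> : (fun h : fock O => \sum_(j <- j :: s) G j h) =
    fun h => G j h + \sum_(j <- s) G j h.
  by apply/funext => h; rewrite big_cons.
split; first exact: adjointableD.
exists (p + o); split; first by rewrite quoD // (linear_add _ _ ox_in_lin) pG oS.
by move=> z z1; rewrite (linear_add _ _ (gauge_lin z1)) hp // ho // scalerDr.
Qed.

Lemma homog_comp chi chi' (G H : fock O -> fock O) :
  homog chi G -> homog chi' H -> homog (fun z => chi z * chi' z) (G \o H).
Proof.
move=> [aG [ o [oG ho]]] [aH [p [pH hp]]]; split.
  by case: aG aH => G' hG [H' hH]; exists (H' \o G'); apply: is_adj_comp.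
exists (o ** p); rewrite ox_inM oG pH (amc_mul (quoP O)) //; split=> // z z1.
rewrite gauge_mul // ho // hp // (linear_scale _ _ (cmul_linl _)).
by rewrite (linear_scale _ _ (cmul_linr _)) scalerA.
Qed.

Lemma homog_adj chi (G G' : fock O -> fock O) :
  homog chi G -> is_adj G G' -> homog (fun z => (chi z)^*) G'.
Proof.
move=> [aG [ o [oG ho]]] h; split; first by exists G; apply: is_adj_sym.
exists (cadj o); rewrite ox_in_cadj oG (amc_adj (quoP O) h); split=> // z z1.
by rewrite gauge_cadj // ho // cadjZ.
Qed.

Lemma homog_ext chi chi' (G : fock O -> fock O) :
  homog chi G -> (forall z, chi z = chi' z) -> homog chi' G.
Proof.
move=> [aG [ o [oG ho]]] h; split=> //; exists o; split=> // z z1.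
by rewrite -h ho.
Qed.

Definition creation r (x : P r) (G : fock O -> fock O) : Prop :=
  forall n m (y : P n), (r + n = m)%N -> G (fin O y) = fin O (tm m x y).

(** [tau_inf] creates a single leg. Longer tensors are sums of $a_p\otimes b_p$ with $a_p$ in $X$,
    and each leg contributes one factor $z$ to the gauge weight; for $r=0$ the operator is
    [phi_inf]. *)
Lemma creation_ex r (x : P r) :
  exists2 G, creation x G & homog (fun z => z ^+ r) G.
Proof.
elim: r x => [|r IH] x.
  have [_ _ _ tp0s] := tp0_iso P; have [d <-] := tp0s x.
  have [aG hG] := phi_infP O d.
  exists (phi_infO d).
    by move=> n m y <-; rewrite add0n hG tm0l.
  split=> //; exists (phi O d); rewrite phiE; split=> // z z1.
  by rewrite (gauge_phi gammaP) // expr0 scale1r.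
have [I [a [b ->]]] := tensor_sum (tmP (add1n r)) (bP 1%N) (bP r) x.
have /choice[G hG] : forall p, exists G,
    creation (b p) G /\ homog (fun z => z ^+ r) G.
  by move=> p; have [G ? ?] := IH (b p); exists G.
have [_ _ _ tp1s] := tp1_iso P.
have /choice[xi hxi] : forall p, exists xi : X, tp1 xi = a p.
  by move=> p; apply: tp1s.
exists (fun h => \sum_p tau_infO (xi p) (G p h)).
  move=> n m y e; rewrite (tens_suml (tmP e)) fin_sum_big; apply: eq_bigr => p _.
  have [_ ht] := tau_infP O (xi p); have [hc _] := hG p.
  have e' : m = (r + n).+1 by rewrite -e.
  rewrite (hc _ _ _ erefl) ht -hxi; subst m.
  by rewrite (@tmA _ _ _ P 1 r n r.+1 (r + n)%N (r + n).+1).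
apply: homog_sum => p; have [_ ho] := hG p.
apply: (@homog_ext (fun z => z * z ^+ r)); last by move=> z; rewrite exprS.
apply: homog_comp ho; have [aT _] := tau_infP O (xi p).
split=> //; exists (tau O (xi p)); rewrite tauE; split=> // z z1.
exact: (gauge_tau gammaP).
Qed.

(** The adjoint is found by testing against the summands of the Fock module, which are orthogonal in
    distinct degrees. *)
Lemma annihilation r (x : P r) G G' : creation x G -> is_adj G G' ->
  (forall n (w : P n), (n < r)%N -> G' (fin O w) = 0) /\
  (forall n m (y : P r) (w : P n), (r + n = m)%N ->
    G' (fin O (tm m y w)) = fin O (lact (ip x y) w)).
Proof.
move=> hG aG; split=> [n w lt|n m y w e]; apply: fock_ext => k v.
  rewrite -aG (hG _ _ _ erefl) ip0r fin_orth // => e.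
  by move: lt; rewrite -e ltnNge leq_addr.
rewrite -aG (hG _ _ _ erefl); subst m; have [e|ne] := eqVneq k n.
  by subst k; rewrite !fin_ip (tens_ip (tmP erefl)).
by rewrite !fin_orth //; [apply/eqP|move/addnI/eqP; apply/negP].
Qed.

(* G is T (x) id on the X^n with n >= r, and 0 on the others. *)
Definition amplifies r s (T : P r -> P s) (G : fock O -> fock O) : Prop :=
  [/\ adjointable G,
      forall n (x : P n), (n < r)%N -> G (fin O x) = 0 &
      forall q n m (x : P r) (y : P q), (r + q = n)%N -> (s + q = m)%N ->
        G (fin O (tm n x y)) = fin O (tm m (T x) y)].

Lemma adj_sum (I : finType) (G G' : I -> fock O -> fock O) :
  (forall j, is_adj (G j) (G' j)) ->
  is_adj (fun h => \sum_j G j h) (fun h => \sum_j G' j h).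
Proof.
by move=> h x y; rewrite ip_suml ip_sumr; apply: eq_bigr => j _; apply: h.
Qed.

(** $L_j$ creates $a_j$ and $M'_j$ annihilates $b_j$, which kills the degrees below $r$. With the
    two families exchanged, the same statement describes the adjoint. *)
Lemma amplifies_finrank_half r s (I : finType) (a : I -> P s) (b : I -> P r)
    (L L' M M' : I -> fock O -> fock O) :
  (forall j, creation (a j) (L j)) -> (forall j, creation (b j) (M j)) ->
  (forall j, is_adj (L j) (L' j)) -> (forall j, is_adj (M j) (M' j)) ->
  amplifies (finrank a b) (fun h => \sum_j L j (M' j h)).
Proof.
move=> hL hM aL aM.
have L0 j : L j 0 = 0.
  by apply: rlinear0; apply: adj_rlinear; exists (L' j).
have aS : is_adj (fun h => \sum_j L j (M' j h)) (fun h => \sum_j M j (L' j h)).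
  by apply: adj_sum => j; apply: is_adj_comp (is_adj_sym _).
split; first by eexists; exact: aS.
  move=> n x lt; rewrite big1 // => j _.
  by have [-> //] := annihilation (hM j) (aM j); rewrite L0.
move=> q n m x y en em; rewrite /finrank (tens_suml (tmP em)) fin_sum_big.
apply: eq_bigr => j _; have [_ -> //] := annihilation (hM j) (aM j).
by rewrite (hL j _ _ _ em) (tens_bal (tmP em)).
Qed.

Lemma amplifies_finrank r s (I : finType) (a : I -> P s) (b : I -> P r) :
  exists G G', [/\ amplifies (finrank a b) G, amplifies (finrank b a) G',
    is_adj G G' & homog (fun z => z ^+ s * (z ^+ r)^*) G].
Proof.
have crea k (c : I -> P k) : exists LL : I -> (fock O -> fock O) * (fock O -> fock O),
    forall j, [/\ creation (c j) (LL j).1, is_adj (LL j).1 (LL j).2 &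
      homog (fun z => z ^+ k) (LL j).1].
  have /choice[LL hLL] : forall j, exists LL : (fock O -> fock O) * (fock O -> fock O),
      [/\ creation (c j) LL.1, is_adj LL.1 LL.2 & homog (fun z => z ^+ k) LL.1].
    move=> j; have [L hL oL] := creation_ex (c j); have [[L' aL] _] := oL.
    by exists (L, L').
  by exists LL.
have [L hL] := crea _ a; have [M hM] := crea _ b.
exists (fun h => \sum_j (L j).1 ((M j).2 h)), (fun h => \sum_j (M j).1 ((L j).2 h)).
have cL j : creation (a j) (L j).1 by case: (hL j).
have cM j : creation (b j) (M j).1 by case: (hM j).
have aL j : is_adj (L j).1 (L j).2 by case: (hL j).
have aM j : is_adj (M j).1 (M j).2 by case: (hM j).
split.
- exact: amplifies_finrank_half cL cM aL aM.
- exact: amplifies_finrank_half cM cL aM aL.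
- by apply: adj_sum => j; apply: is_adj_comp (aL j) (is_adj_sym (aM j)).
- apply: homog_sum => j; apply: homog_comp; first by case: (hL j).
  by apply: homog_adj (aM j); case: (hM j).
Qed.

(** For $n\ge r$ every element of $X^n$ is a finite sum of tensors from $X^r\otimes X^{n-r}$, so the
    clauses of [amplifies] fix the operator on each summand. *)
Lemma amplifies_unique r s (T : P r -> P s) G G' :
  amplifies T G -> amplifies T G' -> G = G'.
Proof.
move=> [aG G0 GT] [aG' G0' GT']; apply/funext.
apply: (adjointable_eq_span aG aG' fin_dense) => c _ [n [x ->]].
rewrite finZ; move: {c x}(c *: x) => x.
have [lt|ge] := ltnP n r; first by rewrite G0 // G0'.
have [I [y [z ->]]] := tensor_sum (tmP (subnKC ge)) (bP _) (bP _) x.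
rewrite fin_sum_big (rlinear_sum _ (adj_rlinear aG)).
rewrite (rlinear_sum _ (adj_rlinear aG')); apply: eq_bigr => p _.
by rewrite (GT _ _ _ _ _ (subnKC ge) erefl) (GT' _ _ _ _ _ (subnKC ge) erefl).
Qed.

(** [o] is the class of $T\otimes\mathrm{id}$ modulo compact operators. It is a relation because the
    Fock operator is provided for right linear [T] only. *)
Definition amp r s (T : P r -> P s) (o : O) : Prop :=
  exists2 G, amplifies T G & ox_in o = quoO G.

Lemma amp_ex_adj r s (T : P r -> P s) : rlinear T ->
  exists o T', [/\ is_adj T T', rlinear T', amp T o, amp T' (cadj o) &
    forall z, `|z| = 1 -> gamma z o = (z ^+ s * (z ^+ r)^*) *: o].
Proof.
move=> rT; have [I [u hu]] := bP r.
rewrite (rlinear_finrank hu rT); move: (T \o u) => a.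
have [G [G' [hG hG' aG [_ [ o [oG go]]]]]] := amplifies_finrank a u.
exists o, (finrank u a); split => //.
- exact: finrank_adj.
- exact: finrank_rlinear.
- by exists G.
- by exists G' => //; rewrite ox_in_cadj oG (amc_adj (quoP O) aG).
Qed.

Lemma amp_fun r s (T : P r -> P s) o o' : amp T o -> amp T o' -> o = o'.
Proof.
move=> [G hG oG] [G' hG' oG']; apply: ox_in_inj.
by rewrite oG oG' (amplifies_unique hG hG').
Qed.

Lemma amp_ex r s (T : P r -> P s) : rlinear T -> exists o, amp T o.
Proof. by move=> /amp_ex_adj [ o [T' [_ _ h _ _]]]; exists o. Qed.

Lemma amp_gauge r s (T : P r -> P s) o : rlinear T -> amp T o ->
  forall z, `|z| = 1 -> gamma z o = (z ^+ s * (z ^+ r)^*) *: o.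
Proof.
by move=> /amp_ex_adj [ o' [T' [_ _ h _ go]]] /(amp_fun h) <-.
Qed.

Lemma amp_star r s (T : P r -> P s) o : rlinear T -> amp T o ->
  exists T', [/\ is_adj T T', rlinear T' & amp T' (cadj o)].
Proof.
by move=> /amp_ex_adj [ o' [T' [? ? h ? _]]] /(amp_fun h) <-; exists T'.
Qed.

Lemma amp_comp r s t (T : P s -> P t) (S : P r -> P s) o p :
  amp T o -> amp S p -> amp (T \o S) (o ** p).
Proof.
move=> [G [aG G0 GT] oG] [H [aH H0 HS] oH]; exists (G \o H).
  split=> [|n x lt|q n m x y en em].
  - by case: aG aH => G' hG [H' hH]; exists (H' \o G'); apply: is_adj_comp.
  - by rewrite /= H0 // (rlinear0 (adj_rlinear aG)).
  - by rewrite /= (HS _ _ _ _ _ en erefl) (GT _ _ _ _ _ erefl em).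
by rewrite ox_inM oG oH (amc_mul (quoP O)).
Qed.

Lemma amp_lin r s (T S : P r -> P s) o p k :
  amp T o -> amp S p -> amp (fun x => k *: T x + S x) (k *: o + p).
Proof.
move=> [G [aG G0 GT] oG] [H [aH H0 HS] oH].
exists (fun h => k *: G h + H h); last first.
  by rewrite ox_in_lin oG oH (amc_lin (quoP O)).
split=> [|n x lt|q n m x y en em].
- case: aG aH => G' hG [H' hH]; exists (fun h => k^* *: G' h + H' h) => x y.
  by rewrite ipDl ipZl ipDr ipZr hG hH.
- by rewrite G0 // H0 // scaler0 addr0.
- rewrite (GT _ _ _ _ _ en em) (HS _ _ _ _ _ en em) (tens_linl (tmP em)).
  by case: (fin_rlinear m) => ->.
Qed.

Variables (A : cstarAlg R) (i : A -> O) (Dk : dbimod i).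
Hypothesis (iP : star_embedding i).

(** The point at which the inductive limit is tied to $\mathcal{O}_X$; other degrees reach it
    through products $o^*o$. *)
Lemma amp_did r (T : P r -> P r) o : rlinear T -> amp T o -> i (did (dj Dk 0 T)) = o.
Proof.
move=> rT [G [aG G0 GT] oG]; apply: ox_in_inj.
rewrite oG (@did_dj _ _ _ _ _ _ _ Dk r T G) // => q n x y e.
exact: GT.
Qed.

(* The operators of T and of T (x) id_X differ by a compact operator.  Rather than
   exhibiting it, compare the four products of o, o' and their adjoints, which
   live in degree 0 where did_dj and dj_amp identify them. *)
Lemma amp_step r s (T : P r -> P s) (T' : P r.+1 -> P s.+1) o :
  rlinear T -> rlinear T' ->
  (forall (x : P r) (y : P 1%N), T' (tm r.+1 x y) = tm s.+1 (T x) y) ->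
  amp T o -> amp T' o.
Proof.
move=> rT rT' hT aT.
have [S [adS rS aS]] := amp_star rT aT.
have [ o' aT'] := amp_ex rT'.
have [S' [adS' rS' aS']] := amp_star rT' aT'.
have hS (w : P s) (y : P 1%N) : S' (tm s.+1 w y) = tm r.+1 (S w) y.
  apply: (tens_ext (tmP (addn1 r))) => a b.
  rewrite -adS' hT (tens_ip (tmP (addn1 s))) (tens_ip (tmP (addn1 r))).
  by rewrite adS.
have rST := rlinear_comp rS rT; have rST' := rlinear_comp rS' rT'.
have hST (x : P r) (y : P 1%N) : (S' \o T') (tm r.+1 x y) = tm r.+1 ((S \o T) x) y.
  by rewrite /= hT hS.
have e1 : cadj o ** o = cadj o' ** o'.
  rewrite -(amp_did rST (amp_comp aS aT)) -(amp_did rST' (amp_comp aS' aT')).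
  by congr (i (did _)); symmetry; apply: dj_amp hST.
(* A mixed product, which compares two levels directly: on $X^{s+1}\otimes X^q=X^s\otimes X^{q+1}$
   the operator of [S] acts as [S'], so it may replace that of [S'] after [T']. *)
have e2 : cadj o ** o' = cadj o' ** o'.
  apply: (@amp_fun _ _ (S' \o T')); last exact: amp_comp.
  have [GS [aGS GS0 GSS] oGS] := aS; have [GT [aGT GT0 GTT] oGT] := aT'.
  exists (GS \o GT); last by rewrite ox_inM oGS oGT (amc_mul (quoP O)).
  split=> [|n x lt|q n m x y en em].
  - by case: aGS aGT => G' hG [H' hH]; exists (H' \o G'); apply: is_adj_comp.
  - by rewrite /= GT0 // (rlinear0 (adj_rlinear aGS)).
  rewrite /= (GTT _ _ _ _ _ en erefl).
  have [I [a [b ->]]] := tensor_sum (tmP (addn1 s)) (bP _) (bP _) (T' x).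
  rewrite (rlinear_sum _ rS') !(tens_suml (tmP _)) // !fin_sum_big.
  rewrite (rlinear_sum _ (adj_rlinear aGS)); apply: eq_bigr => p _.
  rewrite hS (@tmA _ _ _ P s 1 q s.+1 q.+1 (s.+1 + q)%N (addn1 s) (add1n q)) //.
  rewrite (@tmA _ _ _ P r 1 q r.+1 q.+1 m (addn1 r) (add1n q)) //.
  by rewrite (GSS q.+1 _ m) // ?addnS // -addSn em.
have e3 : cadj o' ** o = cadj o' ** o'.
  by rewrite -[LHS]cadjK cadjM cadjK e2 cadjM cadjK.
suff -> : o = o' by [].
apply/eqP; rewrite -subr_eq0 -normr_eq0 -sqrf_eq0 -cnorm_cstar cadjB.
rewrite (linear_sub (cmul_linl _)) !(linear_sub (cmul_linr _)) e1 e2 e3.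
by rewrite !subrr normr0.
Qed.

(** Tensoring with identities brings elements of the inductive limit to a common level, where sums
    and compositions are those of operators. *)
Lemma amp_raise (k : int) r s (T : P r -> P s) o r' s' :
  s%:Z = k + r%:Z -> s'%:Z = k + r'%:Z -> (r <= r')%N -> rlinear T -> amp T o ->
  exists T' : P r' -> P s', [/\ rlinear T', dj Dk k T' = dj Dk k T & amp T' o].
Proof.
move=> e e' le rT aT.
have := subnKC le; move: (r' - r)%N => j er.
have es : s' = (s + j)%N by apply/eqP; rewrite -eqz_nat e' -er !PoszD addrA -e.
elim: j r' s' er es {e' le} => [|j IH] r' s'.
  by rewrite !addn0 => <- ->; exists T.
rewrite !addnS => <- ->.
have [T' [rT' dT' aT']] := IH _ _ erefl erefl.
have [T2 [rT2 hT2]] := tensor_map (tmP (addn1 (r + j))) (tmP (addn1 (s + j)))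
  (bP _) (bP _) rT'.
exists T2; split => //; last exact: amp_step hT2 aT'.
by rewrite -dT'; apply: dj_amp hT2 => //; rewrite !PoszD addrA -e.
Qed.

End Fock.

(** * Spectral subspaces of the Cuntz-Pimsner algebra *)

Section Span.
Variables (R : realType) (V : lmodType R[i]) (S : set V).

Lemma lspan_incl x : S x -> lspan S x.
Proof.
move=> Sx; exists 1%N, (fun=> 1), (fun=> x); split=> //.
by rewrite big_ord1 scale1r.
Qed.

Lemma lspan0 : lspan S 0.
Proof.
exists 0%N, (fun=> 0), (fun=> 0); split; first by case.
by rewrite big_ord0.
Qed.

Lemma lspanD x y : lspan S x -> lspan S y -> lspan S (x + y).
Proof.
move=> [n [c [v [Sv ->]]]] [m [c' [v' [Sv' ->]]]].
exists (n + m)%N, (fun j => match fintype.split j with inl a => c a | inr b => c' b end),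
  (fun j => match fintype.split j with inl a => v a | inr b => v' b end).
split=> [j|]; first by case: (fintype.split j).
rewrite big_split_ord /=; congr (_ + _); apply: eq_bigr => j _.
  by have -> : fintype.split (lshift m j) = inl j by exact: (unsplitK (inl j)).
by have -> : fintype.split (rshift n j) = inr j by exact: (unsplitK (inr j)).
Qed.

Lemma lspanZ k x : lspan S x -> lspan S (k *: x).
Proof.
move=> [n [c [v [Sv ->]]]]; exists n, (fun j => k * c j), v; split=> //.
by rewrite scaler_sumr; apply: eq_bigr => j _; rewrite scalerA.
Qed.

Lemma lspan_sum (I : finType) (x : I -> V) :
  (forall j, lspan S (x j)) -> lspan S (\sum_j x j).
Proof.
by move=> h; elim/big_ind: _ => //; [exact: lspan0|exact: lspanD].
Qed.

End Span.

Lemma lspan_mul (R : realType) (B : cstarAlg R) (S : set B) :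
  (forall x y, S x -> S y -> S (x ** y)) ->
  forall x y, lspan S x -> lspan S y -> lspan S (x ** y).
Proof.
move=> SM _ y [n [c [v [Sv ->]]]] [m [c' [v' [Sv' ->]]]].
rewrite (linear_bigsum _ (cmul_linl _)); apply: lspan_sum => j.
rewrite (linear_bigsum _ (cmul_linr _)); apply: lspan_sum => l.
rewrite (linear_scale _ _ (cmul_linl _)) (linear_scale _ _ (cmul_linr _)).
by do 2!apply: lspanZ; apply: lspan_incl; apply: SM.
Qed.

Lemma lspan_cadj (R : realType) (B : cstarAlg R) (S : set B) :
  (forall x, S x -> S (cadj x)) -> forall x, lspan S x -> lspan S (cadj x).
Proof.
move=> SA _ [n [c [v [Sv ->]]]].
rewrite (badd_sum _ (badd_cadj B)); apply: lspan_sum => j.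
by rewrite cadjZ; apply: lspanZ; apply: lspan_incl; apply: SA.
Qed.

(* f k realizes (k)D as the spectral subspace of degree k in B. *)
Record graded_rep (R : realType) (D : cstarAlg R) (X : corr D D)
    (P : tensor_powers X) (O : cuntz_pimsner P) (A : cstarAlg R) (i : A -> O)
    (Dk : dbimod i) (B : cstarAlg R) (f : forall k, Dk k -> B) (E : B -> A) : Prop := {
  gr_lin : forall k, linear (f k);
  gr_bound : exists2 L : R[i], 0 <= L & forall k x, `|f k x| <= L * `|x|;
  gr_mul : forall k l m x y, k + l = m -> f m (Defs.dcomp m x y) = f k x ** f l y;
  gr_star : forall k l x, l = - k -> f l (dstar l x) = cadj (f k x);
  gr_dense : dense (lspan [set b | exists k x, b = f k x]);
  gr_E : badd E;
  gr_E0 : forall x, E (f 0 x) = did x;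
  gr_Ek : forall k x, k <> 0 -> E (f k x) = 0 }.

(** * Averages over roots of unity *)

Section Circle.
Variable R : realType.

Lemma circD (a b : R) : circ (a + b) = circ a * circ b.
Proof.
rewrite /circ mulrDr cosD sinD; congr (_ +i* _).
by rewrite addrC mulrC [X in _ + X]mulrC.
Qed.

Lemma circ0 : circ (0 : R) = 1.
Proof. by rewrite /circ mulr0 cos0 sin0. Qed.

(** Used to show that a root of unity differs from 1 without studying where cosine and sine take
    given values: one of its powers is $-1$. *)
Lemma circ_half : circ (1 / 2 : R) = -1.
Proof.
rewrite /circ div1r mulrAC mulfV ?mul1r ?cospi ?sinpi ?pnatr_eq0 //.
by apply/eqP; rewrite eq_complex /= oppr0 !eqxx.
Qed.

Lemma circMn (a : R) n : circ (n%:R * a) = circ a ^+ n.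
Proof.
elim: n => [|n IH]; first by rewrite mul0r circ0 expr0.
by rewrite -natr1 mulrDl mul1r circD IH exprSr.
Qed.

Lemma circ_conj (a : R) : circ a * (circ a)^* = 1.
Proof.
apply/eqP; rewrite eq_complex /=; apply/andP; split.
  by rewrite mulrN opprK -!expr2 cos2Dsin2.
by rewrite mulrN addrC mulrC subrr.
Qed.

Lemma circ_norm (a : R) : `|circ a| = 1.
Proof.
by apply/eqP; rewrite -(@eqrXn2 _ 2) // normCK circ_conj expr1n.
Qed.

End Circle.

Section Riemann.
Variables (R : realType).

(* The roots of unity of order n give an equal partition of the circle. *)
Definition circ_mean (V : normedModType R[i]) (f : R[i] -> V) (n : nat) : V :=
  \sum_(j < n) (n%:R^-1)%:C *: f (circ (n%:R^-1) ^+ j).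

(** The partition points and the tags are both $j/n$, so the mesh is $1/n$, below $\delta$ for large
    $n$. *)
Lemma haar_int_mean (V : normedModType R[i]) (f : R[i] -> V) v :
  is_haar_int f v -> forall eps : R, 0 < eps ->
  exists N, forall n, (N <= n)%N -> (0 < n)%N -> `|v - circ_mean f n| <= eps%:C.
Proof.
move=> hf eps e0; have [delta d0 hd] := hf eps e0.
exists (Num.bound delta^-1) => n Nn n0.
have np : 0 < n%:R :> R by rewrite ltr0n.
pose t (j : nat) : R := j%:R / n%:R.
have step j : t j.+1 - t j = n%:R^-1.
  by rewrite /t -mulrBl -natr1 addrC addKr mul1r.
have := hd n t t; rewrite /t mul0r mulfV ?gt_eqF // => /(_ erefl erefl).
have -> : \sum_(j < n) (j.+1%:R / n%:R - j%:R / n%:R)%:C *: f (circ (j%:R / n%:R)) =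
    circ_mean f n.
  by apply: eq_bigr => j _; rewrite -[_ - _]/(t j.+1 - t j) step circMn.
apply=> j jn; split=> //.
  by rewrite ler_pM2r ?invr_gt0 // ler_nat.
rewrite -[_ - _]/(t j.+1 - t j) step invf_ple ?posrE //.
by rewrite (le_trans (ltW (archi_boundP _))) ?invr_ge0 ?(ltW d0) // ler_nat.
Qed.

Lemma circ_mean_cst (V : normedModType R[i]) (v : V) n : (0 < n)%N ->
  circ_mean (fun=> v) n = v.
Proof.
move=> n0; rewrite /circ_mean -scaler_suml sumr_const card_ord -rmorphMn /=.
by rewrite -mulr_natl mulfV ?pnatr_eq0 -?lt0n // scale1r.
Qed.

Lemma circ_mean_geo (V : normedModType R[i]) (w : R[i]) (v : V) n :
  w != 1 -> w ^+ n = 1 -> \sum_(j < n) (n%:R^-1)%:C *: (w ^+ j *: v) = 0.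
Proof.
move=> w1 wn; rewrite -scaler_sumr -scaler_suml.
suff -> : \sum_(j < n) w ^+ j = 0 by rewrite scale0r scaler0.
have := subrX1 w n; rewrite wn subrr => /esym/eqP.
by rewrite mulf_eq0 subr_eq0 (negbTE w1) => /eqP.
Qed.

Lemma circ_mean_le (V : normedModType R[i]) (f : R[i] -> V) (c : R[i]) n :
  0 <= c -> (forall z, `|z| = 1 -> `|f z| <= c) -> `|circ_mean f n| <= c.
Proof.
move=> c0 hf; have [->|n0] := posnP n; first by rewrite /circ_mean big_ord0 normr0.
rewrite (le_trans (ler_norm_sum _ _ _)) //.
apply: (@le_trans _ _ (\sum_(j < n) (n%:R^-1)%:C * c)).
  apply: ler_sum => j _; rewrite normrZ ger0_norm ?lecR ?invr_ge0 //.
  by apply: ler_wpM2l; rewrite ?lecR ?invr_ge0 // hf // normrX circ_norm expr1n.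
rewrite sumr_const card_ord -mulrnAl -rmorphMn /= -mulr_natl mulfV ?pnatr_eq0 -?lt0n //.
by rewrite mul1r.
Qed.

End Riemann.

(** * The gauge expectation and the realization of $(k)D$ in $\mathcal{O}_X$ *)

Section OSide.
Variables (R : realType) (D : cstarAlg R) (X : corr D D) (P : tensor_powers X).
Variables (O : cuntz_pimsner P) (gamma : R[i] -> O -> O).
Hypotheses (gammaP : is_gauge gamma) (bX : rbasis X).
Variables (A : cstarAlg R) (i : A -> O) (Dk : dbimod i).
Hypothesis (iP : is_fixed_algebra gamma i).
Variable (E : O -> A).
Hypothesis (EP : is_gauge_expectation gamma i E).

Let iE : star_embedding i := proj1 iP.

Lemma incl_norm a : `|i a| = `|a|. Proof. by have [_] := iE. Qed.
Lemma incl_lin : linear i. Proof. by have [[]] := iE. Qed.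
Lemma incl_badd : badd i. Proof. exact: badd_iso incl_lin incl_norm. Qed.
Lemma incl_inj a b : i a = i b -> a = b.
Proof.
move=> h; apply/eqP; rewrite -subr_eq0 -normr_eq0 -incl_norm (linear_sub incl_lin).
by rewrite h subrr normr0.
Qed.

Lemma gauge_incl z a : `|z| = 1 -> gamma z (i a) = i a.
Proof.
move=> z1; have : range i (i a) by exists a.
by rewrite (proj2 iP) => /(_ _ z1).
Qed.

Let mean (x : O) n := circ_mean (fun z => gamma z x) n.

Lemma mean_lin n k x y : mean (k *: x + y) n = k *: mean x n + mean y n.
Proof.
rewrite /mean /circ_mean scaler_sumr -big_split /=; apply: eq_bigr => j _.
rewrite (gauge_lin gammaP) ?normrX ?circ_norm ?expr1n // scalerDr.
by rewrite !scalerA [_ * k]mulrC.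
Qed.

Lemma expectation_approx x (eps : R[i]) : 0 < eps ->
  exists N, forall n, (N <= n)%N -> (0 < n)%N -> `|i (E x) - mean x n| <= eps.
Proof.
move=> e0; have [e ee he] := ge0_realC (ltW e0).
by rewrite he; apply: (haar_int_mean (EP x)); rewrite -ltcR -he.
Qed.

(** The means converge to $i(E(x))$, so it suffices to compute them for arbitrarily large $n$ of a
    convenient form. *)
Lemma expectation_mean x a : (forall N, exists n, [/\ (N <= n)%N, (0 < n)%N & mean x n = i a]) ->
  E x = a.
Proof.
move=> h; apply: incl_inj; apply/eqP; rewrite -subr_eq0; apply/eqP/norm_le_eq0 => eps e0.
have [N hN] := expectation_approx x e0; have [n [Nn n0 <-]] := h N.
exact: hN.
Qed.

Lemma expectation_incl a : E (i a) = a.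
Proof.
apply: expectation_mean => N; exists N.+1; split => //.
rewrite -[RHS](@circ_mean_cst _ _ _ N.+1) //; apply: eq_bigr => j _.
by rewrite gauge_incl // normrX circ_norm expr1n.
Qed.

Lemma expectation_norm x : `|E x| <= `|x|.
Proof.
rewrite -incl_norm; apply/ler_addgt0Pr => e e0; have [N hN] := expectation_approx x e0.
rewrite -(subrK (mean x N.+1) (i (E x))) addrC (le_trans (ler_normD _ _)) // lerD //.
  by apply: circ_mean_le => // z z1; rewrite (gauge_norm gammaP).
exact: hN.
Qed.

Lemma expectation_lin : linear E.
Proof.
move=> k x y; apply: incl_inj; rewrite incl_lin; apply/eqP; rewrite -subr_eq0.
apply/eqP/norm_le_eq0 => e e0.
have K0 : 0 < `|k| + 1 by rewrite ltr_wpDl.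
have d0 : 0 < e / 2 by apply: divr_gt0.
have [N1 h1] := expectation_approx (k *: x + y) d0.
have [N2 h2] := expectation_approx x (divr_gt0 d0 K0).
have [N3 h3] := expectation_approx y (divr_gt0 d0 K0).
pose n := (N1 + N2 + N3).+1.
have n1 : (N1 <= n)%N by rewrite /n -addnA leqW // leq_addr.
have n2 : (N2 <= n)%N by rewrite /n (addnC N1) -addnA leqW // leq_addr.
have n3 : (N3 <= n)%N by rewrite /n leqW // leq_addl.
have g1 := h1 n n1 isT; have g2 := h2 n n2 isT; have g3 := h3 n n3 isT.
rewrite -(subrK (mean (k *: x + y) n) (i (E (k *: x + y)))) -addrA.
rewrite (le_trans (ler_normD _ _)) // [leRHS](splitr e) lerD // mean_lin.
rewrite distrC opprD addrACA -scalerBr (le_trans (ler_normD _ _)) // normrZ.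
apply: le_trans (lerD (ler_wpM2l (normr_ge0 k) g2) g3) _.
by rewrite -{2}[e / 2 / _]mul1r -mulrDl mulrC divfK // gt_eqF.
Qed.

Lemma expectation_badd : badd E.
Proof. by apply: (badd_lin expectation_lin ler01) => x; rewrite mul1r expectation_norm. Qed.

Lemma expectation_weight0 (r s : nat) o : r <> s ->
  (forall z, `|z| = 1 -> gamma z o = (z ^+ s * (z ^+ r)^*) *: o) -> E o = 0.
Proof.
move=> rs ho; apply: expectation_mean => N; rewrite (linear_zero incl_lin).
have [q [q0 hq]] : exists q, (0 < q)%N /\ ((r + q = s) \/ (s + q = r))%N.
  have [lt|lt|//] := ltngtP r s.
    by exists (s - r)%N; rewrite subn_gt0 subnKC ?(ltnW lt); split=> //; left.
  by exists (r - s)%N; rewrite subn_gt0 subnKC ?(ltnW lt); split=> //; right.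
(* For this $n$ the weight $w$ at $e^{2\pi i/n}$ satisfies $w^{N+1}=-1$. Hence $w\ne1$ and $w^n=1$,
   and the mean is a vanishing geometric sum. *)
pose n := (2 * (N.+1 * q))%N.
have n0 : (0 < n)%N by rewrite !muln_gt0 q0.
exists n; split=> //.
  by rewrite /n mulnCA mulnC (leq_trans _ (leq_pmull _ _)) // muln_gt0 q0.
pose w : R[i] := circ (n%:R^-1) ^+ s * (circ (n%:R^-1) ^+ r)^*.
have zz (m : nat) : circ (n%:R^-1 : R) ^+ m * (circ (n%:R^-1) ^+ m)^* = 1.
  by rewrite rmorphXn /= -exprMn circ_conj expr1n.
have wE : w = circ (n%:R^-1) ^+ q \/ w = (circ (n%:R^-1) ^+ q)^*.
  rewrite /w; case: hq => <-.
    by left; rewrite exprD mulrAC zz mul1r.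
  by right; rewrite exprD rmorphM mulrA zz mul1r.
have half : circ (n%:R^-1 : R) ^+ (N.+1 * q) = -1.
  rewrite -circMn -circ_half; congr circ; rewrite /n (natrM _ 2) invfM mulrCA mulfV.
    by rewrite mulr1 div1r.
  by rewrite pnatr_eq0 -lt0n muln_gt0 q0.
have whalf : w ^+ N.+1 = -1.
  case: wE => ->; first by rewrite -exprM mulnC half.
  by rewrite -rmorphXn /= -exprM mulnC half rmorphN1.
rewrite -(@circ_mean_geo _ O w o n).
- apply: eq_bigr => j _; rewrite ho ?normrX ?circ_norm ?expr1n //.
  by rewrite -!exprM ![(j * _)%N]mulnC /w exprMn -!rmorphXn /= -!exprM.
- apply/eqP => w1; move: whalf; rewrite w1 expr1n => /eqP.
  by rewrite -subr_eq0 opprK -mulr2n pnatr_eq0.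
- by rewrite /n mulnCA exprM whalf exprM sqrrN !expr1n.
Qed.

(** One element of the algebraic limit comes from operators at many levels, hence a relation;
    [realizes_lin] and [realizes_norm] make it single-valued. *)
Definition realizes (k : int) (d : Dk k) (o : O) : Prop :=
  exists r s (T : P r -> P s),
    [/\ s%:Z = k + r%:Z, rlinear T, d = dj Dk k T & amp T o].

Lemma realizes_lin k c d o d' o' : @realizes k d o -> @realizes k d' o' ->
  @realizes k (c *: d + d') (c *: o + o').
Proof.
move=> [r [s [T [e rT -> aT]]]] [r' [s' [T' [e' rT' -> aT']]]].
have eN : (s + r')%:Z = k + (r + r')%:Z by rewrite !PoszD addrA -e.
have [S [rS <- aS]] := amp_raise gammaP bX Dk e eN (leq_addr _ _) rT aT.
have [S' [rS' <- aS']] := amp_raise gammaP bX Dk e' eN (leq_addl _ _) rT' aT'.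
exists (r + r')%N, (s + r')%N, (fun x => c *: S x + S' x); split=> //.
- exact: rlinear_lin.
- by rewrite dj_lin.
- exact: amp_lin.
Qed.

Lemma realizes_mul k l m d o d' o' : k + l = m ->
  @realizes k d o -> @realizes l d' o' -> @realizes m (Defs.dcomp m d d') (o ** o').
Proof.
move=> em [s [t [T [e rT -> aT]]]] [r [s' [S [e' rS -> aS]]]].
(* [T] is tensored with $s'$ identities and [S] with $s$, so that they meet at $X^{s+s'}$. *)
have eN : (t + s')%:Z = k + (s + s')%:Z by rewrite !PoszD addrA -e.
have eN' : (s + s')%:Z = l + (s + r)%:Z by rewrite !PoszD e' addrCA.
have [T' [rT' <- aT']] := amp_raise gammaP bX Dk e eN (leq_addr _ _) rT aT.
have [S' [rS' <- aS']] := amp_raise gammaP bX Dk e' eN' (leq_addl _ _) rS aS.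
exists (s + r)%N, (t + s')%N, (T' \o S'); split.
- by rewrite -em eN eN' addrA.
- exact: rlinear_comp.
- by rewrite (dcomp_dj _ _ eN eN').
- exact: amp_comp.
Qed.

Lemma realizes_star k l d o : l = - k ->
  @realizes k d o -> @realizes l (dstar l d) (cadj o).
Proof.
move=> el [r [s [T [e rT -> aT]]]].
have [T' [aTT' rT' aT']] := amp_star gammaP bX rT aT.
exists s, r, T'; split=> //; first by rewrite el e addKr.
by rewrite (dstar_dj _ el e rT aTT').
Qed.

Lemma realizes0 (d : Dk 0) o : realizes d o -> o = i (did d).
Proof.
move=> [r [s [T [e rT -> aT]]]].
have es : s = r by apply/eqP; rewrite -eqz_nat e add0r.
by subst s; rewrite (amp_did Dk rT aT).
Qed.

(** The C*-identity moves the question to $o^*o$, which has degree 0 and equals $i(\langle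
    d|d\rangle)$, and [i] is isometric. *)
Lemma realizes_norm k (d : Dk k) o : realizes d o -> `|o| = `|d|.
Proof.
move=> h; apply/eqP; rewrite -(@eqrXn2 _ 2) //; apply/eqP.
rewrite -cnorm_cstar hm_norm dk_ip -incl_norm; congr (`| _ |).
apply: realizes0; apply: realizes_mul (realizes_star erefl h) h.
by rewrite addNr.
Qed.

Lemma realizes_E k (d : Dk k) o : k <> 0 -> realizes d o -> E o = 0.
Proof.
move=> k0 [r [s [T [e rT _ aT]]]]; apply: (@expectation_weight0 r s) => [ers|].
  apply: k0; move: e; rewrite ers => /eqP.
  by rewrite -subr_eq subrr => /eqP.
exact: (amp_gauge gammaP bX rT aT).
Qed.

Lemma realizes_dense k : dense [set d : Dk k | exists o, realizes d o].
Proof.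
apply/dense_normP => x e e0.
have [_ [r [s [T [h rT ->]]]] le] :=
  (dense_normP _).1 (@dj_dense _ _ _ _ _ _ _ Dk k) x e e0.
exists (dj Dk k T) => //; have [ o aT] := amp_ex gammaP bX rT.
by exists o, r, s, T.
Qed.

Lemma realization_ex k : exists f : Dk k -> O,
  [/\ linear f, forall x, `|f x| = `|x| & forall d o, realizes d o -> f d = o].
Proof.
apply: (@isometry_extension R (Dk k) O (@realizes k)).
- by move=> c v w v' w'; apply: realizes_lin.
- by move=> v w; apply: realizes_norm.
- exact: realizes_dense.
Qed.

End OSide.

(** * Norm closures of star-closed sets *)

Section Closure.
Variables (R : realType) (V : normedModType R[i]) (S : set V).

(** Phrased like [dense_normP]; it supplies the closed set over which [generated_cstar]
    quantifies. *)
Definition nclosure : set V :=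
  [set v | forall e : R[i], 0 < e -> exists2 s, S s & `|v - s| <= e].

Lemma nclosure_incl : S `<=` nclosure.
Proof. by move=> v Sv e e0; exists v; rewrite // subrr normr0 ltW. Qed.

Lemma nclosure_idem (v : V) :
  (forall e : R[i], 0 < e -> exists2 s, nclosure s & `|v - s| <= e) -> nclosure v.
Proof.
move=> h e e0; have e2 : 0 < e / 2 by apply: divr_gt0.
have [s hs vs] := h _ e2; have [s' Ss' ss'] := hs _ e2.
exists s' => //; rewrite -(subrK s v) -addrA (le_trans (ler_normD _ _)) //.
by rewrite [leRHS](splitr e) lerD.
Qed.

Lemma nclosure_closed : closed nclosure.
Proof.
move=> v clv; apply: nclosure_idem => e e0.
have [s [hs bs]] := clv _ (nbhsx_ballx v e e0).
by exists s => //; move: bs; rewrite -ball_normE => /ltW.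
Qed.

Lemma nclosure_badd (f : V -> V) : badd f ->
  (forall s, S s -> nclosure (f s)) -> forall v, nclosure v -> nclosure (f v).
Proof.
move=> [fB [K K0 fK]] hf v hv; apply: nclosure_idem => e e0.
have K1 : 0 < K + 1 by rewrite ltr_wpDl.
have [s Ss vs] := hv _ (divr_gt0 e0 K1).
exists (f s); first exact: hf.
rewrite -fB (le_trans (fK _)) // (le_trans (ler_wpM2l K0 vs)) //.
rewrite mulrCA ler_piMr ?(ltW e0) // ler_pdivrMr // mul1r lerDl //.
Qed.

Lemma nclosureD (v w : V) : (forall s t, S s -> S t -> S (s + t)) ->
  nclosure v -> nclosure w -> nclosure (v + w).
Proof.
move=> SD hv hw e e0; have e2 : 0 < e / 2 by apply: divr_gt0.
have [s Ss vs] := hv _ e2; have [t St wt] := hw _ e2.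
exists (s + t); first exact: SD.
by rewrite opprD addrACA (le_trans (ler_normD _ _)) // [leRHS](splitr e) lerD.
Qed.

End Closure.

Lemma star_closed_nclosure (R : realType) (B : cstarAlg R) (S : set B) :
  star_closed S -> star_closed (nclosure S).
Proof.
move=> [S0 Slin SM SA].
have SD s t : S s -> S t -> S (s + t).
  by move=> Ss St; rewrite -[s]scale1r; apply: Slin.
have SZ k s : S s -> S (k *: s).
  by move=> Ss; rewrite -[_ *: _]addr0; apply: Slin.
have bZ k : badd (fun s : B => k *: s).
  split=> [x y|]; first by rewrite scalerBr.
  by exists `|k| => // x; rewrite normrZ.
split.
- exact: nclosure_incl.
- move=> k a b ha hb; apply: nclosureD => //.
  by apply: (nclosure_badd (bZ k)) ha => s Ss; apply: nclosure_incl; apply: SZ.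
- move=> a b ha hb; apply: (nclosure_badd (badd_cmulr b)) ha => s Ss.
  apply: (nclosure_badd (badd_cmull s)) hb => t St.
  by apply: nclosure_incl; apply: SM.
- move=> a; apply: (nclosure_badd (badd_cadj B)) => s Ss.
  by apply: nclosure_incl; apply: SA.
Qed.

Section DbimodMaps.
Variables (R : realType) (D : cstarAlg R) (X : corr D D) (P : tensor_powers X).
Variables (O : cuntz_pimsner P) (A : cstarAlg R) (i : A -> O) (Dk : dbimod i).

Lemma badd_dcompr (k l m : int) (x : Dk k) : k + l = m ->
  badd (fun y : Dk l => Defs.dcomp m x y : Dk m).
Proof.
move=> e; apply: (badd_lin (dcomp_linr x e) (normr_ge0 x)) => y.
exact: dcomp_norm.
Qed.

Lemma badd_dcompl (k l m : int) (y : Dk l) : k + l = m ->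
  badd (fun x : Dk k => Defs.dcomp m x y : Dk m).
Proof.
move=> e; apply: (badd_lin (dcomp_linl y e) (normr_ge0 y)) => x.
by rewrite mulrC; apply: dcomp_norm.
Qed.

Lemma badd_dstar (k l : int) : l = - k -> badd (fun x : Dk k => dstar l x : Dk l).
Proof.
move=> e; split=> [x y|].
  rewrite addrC -scaleN1r dstar_antilin // rmorphN1 scaleN1r addrC //.
by exists 1 => // x; rewrite mul1r dstar_norm.
Qed.

End DbimodMaps.

(** * The graded representation in $\mathcal{O}_X$ *)

Section OSide2.
Variables (R : realType) (D : cstarAlg R) (X : corr D D) (P : tensor_powers X).
Variables (O : cuntz_pimsner P) (gamma : R[i] -> O -> O).
Hypotheses (gammaP : is_gauge gamma) (bX : rbasis X).
Variables (A : cstarAlg R) (i : A -> O) (Dk : dbimod i).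
Hypothesis (iP : is_fixed_algebra gamma i).
Variable (E : O -> A).
Hypothesis (EP : is_gauge_expectation gamma i E).
Variable (f : forall k, Dk k -> O).
Arguments f : clear implicits.
Hypotheses (f_lin : forall k, linear (f k)) (f_norm : forall k x, `|f k x| = `|x|).
Hypothesis (f_real : forall k d o, @realizes _ _ _ _ O _ i Dk k d o -> f k d = o).

Let f_badd k : badd (f k) := badd_iso (@f_lin k) (@f_norm k).
Let rd k : dense [set d : Dk k | exists o, realizes d o] :=
  @realizes_dense _ _ _ _ _ _ gammaP bX _ _ Dk k.

Lemma realization_mul k l m x y : k + l = m -> f m (Defs.dcomp m x y) = f k x ** f l y.
Proof.
move=> e; refine (badd_eq_dense (badd_comp (f_badd m) (badd_dcompl y e))
  (badd_comp (badd_cmulr (f l y)) (f_badd k)) (@rd k) _ x) => {}x [ o ox] /=.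
refine (badd_eq_dense (badd_comp (f_badd m) (badd_dcompr x e))
  (badd_comp (badd_cmull (f k x)) (f_badd l)) (@rd l) _ y) => {}y [ o' oy] /=.
by rewrite (f_real ox) (f_real oy); apply: f_real; apply: (realizes_mul gammaP bX).
Qed.

Lemma realization_star k l x : l = - k -> f l (dstar l x) = cadj (f k x).
Proof.
move=> e; refine (badd_eq_dense (badd_comp (f_badd l) (badd_dstar Dk e))
  (badd_comp (badd_cadj O) (f_badd k)) (@rd k) _ x) => {}x [ o ox] /=.
by rewrite (f_real ox); apply: f_real; apply: (realizes_star gammaP bX).
Qed.

Lemma realization0 x : f 0 x = i (did x).
Proof.
refine (badd_eq_dense (f_badd 0) (badd_comp (incl_badd iP)
  (badd_iso (did_lin (d:=Dk)) (did_norm (d:=Dk)))) (@rd 0) _ x) => {}x [ o ox] /=.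
by rewrite (f_real ox) (realizes0 ox).
Qed.

Lemma realization_E0 x : E (f 0 x) = did x.
Proof. by rewrite realization0 (expectation_incl iP EP). Qed.

Lemma realization_Ek k x : k <> 0 -> E (f k x) = 0.
Proof.
move=> k0; refine (badd_eq0_dense (badd_comp (expectation_badd gammaP iP EP) (f_badd k))
  (@rd k) _ x) => {}x [ o ox] /=.
by rewrite (f_real ox) (realizes_E gammaP bX iP EP k0 ox).
Qed.

Let S : set O := [set b | exists k x, b = f k x].

Lemma span_star_closed : star_closed (lspan S).
Proof.
split.
- exact: lspan0.
- by move=> k a b ha hb; apply: lspanD => //; apply: lspanZ.
- apply: lspan_mul => _ _ [k [x ->]] [l [y ->]].
  by exists (k + l), (Defs.dcomp (k + l) x y); rewrite (realization_mul x y erefl).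
- apply: lspan_cadj => _ [k [x ->]].
  by exists (- k), (dstar (- k) x); rewrite (realization_star x erefl).
Qed.

Lemma ox_star_closed (K : set O) : star_closed K -> star_closed (@ox_in _ _ _ _ O @` K).
Proof.
move=> [K0 Klin KM KA]; split.
- by exists 0 => //; rewrite (linear_zero (@ox_in_lin _ _ _ _ O)).
- move=> k _ _ [a Ka <-] [b Kb <-]; exists (k *: a + b); first exact: Klin.
  by rewrite ox_in_lin.
- move=> _ _ [a Ka <-] [b Kb <-]; exists (a ** b); first exact: KM.
  by rewrite ox_inM.
- move=> _ [a Ka <-]; exists (cadj a); first exact: KA.
  by rewrite ox_in_cadj.
Qed.

Lemma amp_span r s (T : P r -> P s) o : rlinear T -> amp T o -> lspan S o.
Proof.
move=> rT aT; apply: lspan_incl; exists (s%:Z - r%:Z), (dj Dk _ T).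
symmetry; apply: f_real; exists r, s, T; split=> //.
by rewrite subrK.
Qed.

(** [phi_inf d] is $T\otimes\mathrm{id}$ for [T] the left action of [d] on $X^0$. In the same way
    [tau_inf xi] comes from the map $X^0\to X^1$ that tensors with [xi]. *)
Lemma phi_span d : lspan S (phi O d).
Proof.
have [aG hG] := phi_infP O d.
apply: (@amp_span 0 0 (fun x => lact d x)).
  split=> [|x b]; [exact: lact_linr|exact: lact_ract].
exists (@phi_inf _ _ _ _ O d); last exact: phiE.
split=> // q n m x y; rewrite !add0n => <- <-.
by rewrite hG (tens_lact (tm_tensor P (add0n q))).
Qed.

Lemma tau_span xi : lspan S (tau O xi).
Proof.
have [aG hG] := tau_infP O xi.
have tP := tm_tensor P (addn0 1).
apply: (@amp_span 0 1 (fun x => tm 1 (tp1 xi) x)).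
  split=> [|x b]; first exact: (tens_linr tP).
  by rewrite (tens_ract tP).
exists (@tau_inf _ _ _ _ O xi); last exact: tauE.
split=> // q n m x y; rewrite add0n => <- <-.
by rewrite hG (@tmA _ _ _ P 1 0 q 1 q q.+1).
Qed.

Lemma realization_dense : dense (lspan S).
Proof.
apply/dense_normP => x e e0.
have gx : generated_cstar ([set q | exists d, q = quo (c:=O) (phi_inf d)] `|`
   [set q | exists xi, q = quo (c:=O) (tau_inf xi)]) (ox_in x).
  by rewrite -ox_range; exists x.
(* Generation is stated in the quotient by the compacts, so the closed set is the closure of the
   image of the graded sums there; [ox_in] is isometric, so the approximation comes back to [O]. *)
have [_ [y Sy <-] le] := gx _ (@nclosure_closed _ _ _)
  (star_closed_nclosure (ox_star_closed span_star_closed)) ltac:(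
  by move=> _ [[d ->]|[xi ->]]; apply: nclosure_incl;
     [exists (phi O d); [exact: phi_span|exact: phiE]
     |exists (tau O xi); [exact: tau_span|exact: tauE]]) e e0.
by exists y => //; rewrite -ox_in_norm (linear_sub (@ox_in_lin _ _ _ _ O)).
Qed.

Lemma ox_graded_rep_of : graded_rep f E.
Proof.
split=> //.
- by exists 1 => // k x; rewrite mul1r f_norm.
- exact: realization_mul.
- exact: realization_star.
- exact: realization_dense.
- exact: (expectation_badd gammaP iP EP).
- exact: realization_E0.
- exact: realization_Ek.
Qed.

End OSide2.

Lemma ox_graded_rep (R : realType) (D : cstarAlg R) (X : corr D D) (P : tensor_powers X)
    (O : cuntz_pimsner P) (gamma : R[i] -> O -> O) (A : cstarAlg R) (i : A -> O)
    (Dk : dbimod i) (E : O -> A) :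
  is_gauge gamma -> rbasis X -> is_fixed_algebra gamma i ->
  is_gauge_expectation gamma i E ->
  exists f : forall k, Dk k -> O, graded_rep f E /\ forall x, f 0 x = i (did x).
Proof.
move=> gammaP bX iP EP.
pose f k := projT1 (cid (realization_ex gammaP bX Dk iP k)).
have fP k := projT2 (cid (realization_ex gammaP bX Dk iP k)).
have f_lin k : linear (f k) by case: (fP k).
have f_norm k x : `|f k x| = `|x| by case: (fP k) => _ h _; exact: h.
have f_real k d o : realizes d o -> f k d = o by case: (fP k) => _ _; apply.
exists f; split; first exact: (ox_graded_rep_of gammaP bX iP EP f_lin f_norm f_real).
exact: (realization0 gammaP bX iP f_lin f_norm f_real).
Qed.

(** * Comparison of two graded completions *)

Section GradedSums.
Variables (R : realType) (D : cstarAlg R) (X : corr D D) (P : tensor_powers X).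
Variables (O : cuntz_pimsner P) (A : cstarAlg R) (i : A -> O) (Dk : dbimod i).

Definition degs (n j : nat) : int := j%:Z - n%:Z.

(* The degrees run from -n to n. *)
Definition graded_sum (B : cstarAlg R) (f : forall k, Dk k -> B) n
  (c : forall k, Dk k) : B := \sum_(j < n.*2.+1) f (degs n j) (c (degs n j)).

Lemma degs_inj n (j l : nat) : degs n j = degs n l -> j = l.
Proof. by move=> /addIr [->]. Qed.

Lemma degs_surj n (k : int) : (`|k| <= n)%N -> exists j : 'I_(n.*2.+1), degs n j = k.
Proof.
move=> le.
have kn : k + n%:Z <= n%:Z + n%:Z by rewrite lerD2r (le_trans (ler_norm _)) // -abszE lez_nat.
have k0 : 0 <= k + n%:Z.
  rewrite -lerBlDr sub0r lerNl (le_trans (ler_norm _)) // normrN.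
  by rewrite -abszE lez_nat.
case E : (k + n%:Z) k0 kn => [m|m] // _ mn.
have lt : (m < n.*2.+1)%N by rewrite ltnS -addnn -lez_nat PoszD.
by exists (Ordinal lt); rewrite /degs /= -E addrK.
Qed.

Lemma degs_abs n (j : 'I_(n.*2.+1)) : (`|degs n j| <= n)%N.
Proof.
rewrite -lez_nat abszE ler_norml /degs lerBrDr addNr lerBlDr -PoszD addnn.
by apply/andP; split=> //; rewrite lez_nat -ltnS ltn_ord.
Qed.

(** The type of a coefficient depends on its degree, so [x] is transported along $k=l$ where the
    degrees agree. *)
Lemma single_ex k (x : Dk k) :
  exists c : forall l, Dk l, c k = x /\ forall l, l <> k -> c l = 0.
Proof.
exists (fun l => match pselect (k = l) with
  | left e => eq_rect k (fun l => Dk l : Type) x l e | right _ => 0 end).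
split=> [|l lk]; first by case: pselect => // e; rewrite eq_axiomK.
by case: pselect => // e; case: lk.
Qed.

End GradedSums.

Section OneRep.
Variables (R : realType) (D : cstarAlg R) (X : corr D D) (P : tensor_powers X).
Variables (O : cuntz_pimsner P) (A : cstarAlg R) (i : A -> O) (Dk : dbimod i).
Variables (B : cstarAlg R) (f : forall k, Dk k -> B) (E : B -> A).
Arguments f : clear implicits.
Hypothesis fP : graded_rep f E.

Lemma gr_badd k : badd (f k).
Proof. by have [L L0 fL] := gr_bound fP; apply: (badd_lin (gr_lin fP (k := k)) L0). Qed.

Lemma gr_E_adj k (x y : Dk k) : E (cadj (f k x) ** f k y) = ip x y.
Proof.
rewrite -(gr_star fP x erefl) -(gr_mul fP _ _ (addNr k)) (gr_E0 fP).
by rewrite dk_ip.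
Qed.

Lemma gr_E_orth k l (x : Dk k) (y : Dk l) : l <> k -> E (cadj (f k x) ** f l y) = 0.
Proof.
move=> lk; rewrite -(gr_star fP x erefl) -(gr_mul fP _ _ erefl) (gr_Ek fP) //.
by move/eqP; rewrite addrC subr_eq0 => /eqP.
Qed.

Lemma gr_coef n (c : forall k, Dk k) (l : 'I_(n.*2.+1)) :
  E (cadj (f _ (c (degs n l))) ** graded_sum f n c) = ip (c (degs n l)) (c (degs n l)).
Proof.
rewrite /graded_sum (linear_bigsum _ (cmul_linr _)) (badd_sum _ (gr_E fP)).
rewrite (bigD1 l) //= gr_E_adj big1 ?addr0 // => j jl.
by rewrite gr_E_orth // => /degs_inj /val_inj /eqP; apply/negP.
Qed.

(** Pairing the sum $s$ with the image of its coefficient $x$ under [E] isolates $\langle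
    x|x\rangle$, so $|x|^2\le KL\,|x|\,|s|$. The constant does not involve the number of terms. *)
Lemma gr_coef_bound : exists2 K : R[i], 0 <= K & forall n c (l : 'I_(n.*2.+1)),
  `|c (degs n l)| <= K * `|graded_sum f n c|.
Proof.
have [L L0 fL] := gr_bound fP; have [_ [K K0 EK]] := gr_E fP.
exists (K * L); first exact: mulr_ge0.
move=> n c l; set x := c _.
have [x0|xn] := eqVneq `|x| 0; first by rewrite x0 !mulr_ge0.
have xp : 0 < `|x| by rewrite lt_neqAle eq_sym xn normr_ge0.
rewrite -(ler_pM2l xp) -expr2 hm_norm -gr_coef (le_trans (EK _)) //.
rewrite mulrCA -mulrA; apply: ler_wpM2l => //.
rewrite (le_trans (cnormM _ _)) // cnorm_adj mulrA; apply: ler_wpM2r => //.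
Qed.

Lemma gr_sum_bound : exists2 K : R[i], 0 <= K & forall n (c : forall k, Dk k) (e : R[i]),
  0 <= e -> (forall l : 'I_(n.*2.+1), `|c (degs n l)| <= e) ->
  `|graded_sum f n c| <= K * (n.*2.+1)%:R * e.
Proof.
have [L L0 fL] := gr_bound fP; exists L => // n c e e0 h.
rewrite (le_trans (ler_norm_sum _ _ _)) //.
apply: (@le_trans _ _ (\sum_(j < n.*2.+1) L * e)).
  by apply: ler_sum => j _; rewrite (le_trans (fL _ _)) // ler_wpM2l.
by rewrite sumr_const card_ord -[in leLHS]mulr_natr mulrAC lexx.
Qed.

Lemma graded_sumD n (c c' : forall k, Dk k) :
  graded_sum f n (fun k => c k + c' k) = graded_sum f n c + graded_sum f n c'.
Proof.
rewrite /graded_sum -big_split; apply: eq_bigr => j _ /=.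
exact: linear_add (gr_lin fP (k := _)).
Qed.

Lemma graded_sum0 n : graded_sum f n (fun k => 0) = 0.
Proof.
rewrite /graded_sum big1 // => j _; exact: badd0 (gr_badd _).
Qed.

Lemma graded_sum_single n k (x : Dk k) (c : forall l, Dk l) : (`|k| <= n)%N ->
  c k = x -> (forall l, l <> k -> c l = 0) -> graded_sum f n c = f k x.
Proof.
move=> /degs_surj [j jk] ck c0; rewrite /graded_sum (bigD1 j) //= big1.
  by rewrite addr0; move: jk => ->; rewrite ck.
move=> l lj; rewrite c0 ?(badd0 (gr_badd _)) // -jk => /degs_inj /val_inj /eqP.
by apply/negP.
Qed.

End OneRep.

Section TwoReps.
Variables (R : realType) (D : cstarAlg R) (X : corr D D) (P : tensor_powers X).
Variables (O : cuntz_pimsner P) (A : cstarAlg R) (i : A -> O) (Dk : dbimod i).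

(** The degree bound [n] is recorded because the first comparison of norms depends on it. *)
Definition graded_rel (B1 B2 : cstarAlg R) (f1 : forall k, Dk k -> B1)
    (f2 : forall k, Dk k -> B2) n (x1 : B1) (x2 : B2) : Prop :=
  exists c : forall k, Dk k, x1 = graded_sum f1 n c /\ x2 = graded_sum f2 n c.

Lemma graded_rel_sym (B1 B2 : cstarAlg R) (f1 : forall k, Dk k -> B1)
    (f2 : forall k, Dk k -> B2) n x1 x2 :
  graded_rel f1 f2 n x1 x2 -> graded_rel f2 f1 n x2 x1.
Proof. by move=> [c [? ?]]; exists c. Qed.

Variables (B1 B2 : cstarAlg R) (f1 : forall k, Dk k -> B1) (f2 : forall k, Dk k -> B2).
Arguments f1 : clear implicits.
Arguments f2 : clear implicits.
Variables (E1 : B1 -> A) (E2 : B2 -> A).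
Hypotheses (f1P : graded_rep f1 E1) (f2P : graded_rep f2 E2).

Let G := graded_rel f1 f2.

Lemma graded_relD n a b a' b' : G n a b -> G n a' b' -> G n (a + a') (b + b').
Proof.
move=> [c [-> ->]] [c' [-> ->]]; exists (fun k => c k + c' k).
by rewrite (graded_sumD f1P) (graded_sumD f2P).
Qed.

Lemma graded_rel_sum n (I : finType) (a : I -> B1) (b : I -> B2) :
  (forall j, G n (a j) (b j)) -> G n (\sum_j a j) (\sum_j b j).
Proof.
move=> h; elim/big_rec2: _ => [|j y1 y2 _ IH]; last exact: graded_relD.
by exists (fun=> 0); rewrite (graded_sum0 f1P) (graded_sum0 f2P).
Qed.

Lemma graded_rel_single n k (x : Dk k) : (`|k| <= n)%N -> G n (f1 k x) (f2 k x).
Proof.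
move=> le; have [c [ck c0]] := single_ex x; exists c.
by rewrite (graded_sum_single f1P le ck c0) (graded_sum_single f2P le ck c0).
Qed.

(** The family [c] may be nonzero outside the degrees from $-n$ to $n$, so it cannot be reused for
    [m]; the sum is rebuilt from its single terms. *)
Lemma graded_rel_mono n m a b : (n <= m)%N -> G n a b -> G m a b.
Proof.
move=> le [c [-> ->]]; apply: graded_rel_sum => j; apply: graded_rel_single.
exact: leq_trans (degs_abs j) le.
Qed.

Lemma graded_relZ n k a b : G n a b -> G n (k *: a) (k *: b).
Proof.
move=> [c [-> ->]]; rewrite /graded_sum !scaler_sumr.
apply: graded_rel_sum => j.
rewrite -(linear_scale _ _ (gr_lin f1P (k := _))) -(linear_scale _ _ (gr_lin f2P (k := _))).
exact: graded_rel_single (degs_abs j).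
Qed.

Lemma graded_rel_star n a b : G n a b -> G n (cadj a) (cadj b).
Proof.
move=> [c [-> ->]]; rewrite /graded_sum !(badd_sum _ (badd_cadj _)).
apply: graded_rel_sum => j; rewrite -(gr_star f1P _ erefl) -(gr_star f2P _ erefl).
by apply: graded_rel_single; rewrite abszN degs_abs.
Qed.

Lemma graded_rel_mul n m a b a' b' :
  G n a b -> G m a' b' -> G (n + m)%N (a ** a') (b ** b').
Proof.
move=> [c [-> ->]] [c' [-> ->]]; rewrite /graded_sum.
rewrite !(linear_bigsum _ (cmul_linl _)); apply: graded_rel_sum => j.
rewrite !(linear_bigsum _ (cmul_linr _)); apply: graded_rel_sum => l.
rewrite -(gr_mul f1P _ _ erefl) -(gr_mul f2P _ _ erefl).
apply: graded_rel_single; apply: leq_trans (leq_add (degs_abs j) (degs_abs l)).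
by rewrite -lez_nat PoszD !abszE ler_normD.
Qed.

Lemma graded_rel_le n a b : G n a b -> `|a| <= `|b|.
Proof.
have [K K0 hK] := gr_sum_bound f1P; have [L L0 hL] := gr_coef_bound f2P.
(* The degree bound is made positive because $2m+1\le3m$ needs $m>0$; this is the 3 in the constant
   below. *)
move=> g; have {g} g : (0 < n.+1)%N /\ G n.+1 a b.
  by split=> //; apply: graded_rel_mono g.
apply: (@norm_le_of_graded_bound R _ _ (fun n a b => (0 < n)%N /\ G n a b)
  (K * 3%:R * L) _ _ _ n.+1) => //.
- by rewrite !mulr_ge0.
- move=> m x y [m0 g']; split; first by rewrite addn_gt0 m0.
  exact: graded_rel_mul (graded_rel_star g') g'.
- move=> m _ _ [m0 [c [-> ->]]].
  apply: le_trans (hK m c (L * `|graded_sum f2 m c|) _ _) _.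
  + exact: mulr_ge0.
  + exact: hL.
  rewrite mulrA; apply: ler_wpM2r => //.
  rewrite mulrAC -!mulrA; apply: ler_wpM2l => //.
  rewrite mulrCA; apply: ler_wpM2l => //.
  by rewrite -natrM ler_nat !mulSn mul0n addn0 addnA addnn -addn1 leq_add2l.
Qed.

End TwoReps.

Section Iso.
Variables (R : realType) (D : cstarAlg R) (X : corr D D) (P : tensor_powers X).
Variables (O : cuntz_pimsner P) (A : cstarAlg R) (i : A -> O) (Dk : dbimod i).

Lemma lspan_graded_rel (B1 B2 : cstarAlg R) (f1 : forall k, Dk k -> B1)
    (f2 : forall k, Dk k -> B2) (E1 : B1 -> A) (E2 : B2 -> A) :
  graded_rep f1 E1 -> graded_rep f2 E2 ->
  forall a, lspan [set b | exists k x, b = f1 k x] a ->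
  exists b n, graded_rel f1 f2 n a b.
Proof.
move=> f1P f2P _ [n [c [v [Sv ->]]]].
have h j : exists b m, graded_rel f1 f2 m (c j *: v j) b.
  have [k [x ->]] := Sv j; exists (c j *: f2 k x), `|k|%N.
  by apply: (graded_relZ f1P f2P); apply: (graded_rel_single f1P f2P).
elim/big_rec: _ => [|j y _ [b [m g]]].
  by exists 0, 0%N, (fun=> 0); rewrite (graded_sum0 f1P) (graded_sum0 f2P).
have [b' [m' g']] := h j; exists (b' + b), (m' + m)%N.
apply: (graded_relD f1P f2P).
  exact: (graded_rel_mono f1P f2P (leq_addr m m') g').
exact: (graded_rel_mono f1P f2P (leq_addl m' m) g).
Qed.

Lemma graded_extension (B1 B2 : cstarAlg R) (f1 : forall k, Dk k -> B1)
    (f2 : forall k, Dk k -> B2) (E1 : B1 -> A) (E2 : B2 -> A) :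
  graded_rep f1 E1 -> graded_rep f2 E2 ->
  exists Phi : B1 -> B2, [/\ linear Phi, forall x, `|Phi x| = `|x| &
    forall k x, Phi (f1 k x) = f2 k x].
Proof.
move=> f1P f2P.
have [||| Phi [lPhi nPhi hPhi]] := @isometry_extension R B1 B2
    (fun a b => exists n, graded_rel f1 f2 n a b).
- move=> k v w v' w' [n g] [m g']; exists (n + m)%N.
  apply: (graded_relD f1P f2P); last exact: (graded_rel_mono f1P f2P (leq_addl n m) g').
  by apply: (graded_relZ f1P f2P); exact: (graded_rel_mono f1P f2P (leq_addr m n) g).
- move=> v w [n g]; apply/eqP; rewrite eq_le (graded_rel_le f1P f2P g) andbT.
  by rewrite (graded_rel_le f2P f1P (graded_rel_sym g)).
- apply/dense_normP => x e e0; have [y Sy le] := (dense_normP _).1 (gr_dense f1P) x e e0.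
  by exists y => //; apply: lspan_graded_rel f1P f2P _ Sy.
exists Phi; split=> // k x; apply: hPhi; exists `|k|%N.
exact: (graded_rel_single f1P f2P).
Qed.

Lemma graded_eq (B : cstarAlg R) (f : forall k, Dk k -> B) (E : B -> A)
    (V : normedModType R[i]) (g h : B -> V) :
  graded_rep f E -> badd g -> badd h -> (forall k x, g (f k x) = h (f k x)) ->
  forall b, g b = h b.
Proof.
move=> fP bg bh e; apply: (badd_eq_span bg bh (gr_dense fP)) => c _ [k [x ->]].
by rewrite -(linear_scale _ _ (gr_lin fP (k := k))).
Qed.

Lemma graded_iso (B1 B2 : cstarAlg R) (f1 : forall k, Dk k -> B1)
    (f2 : forall k, Dk k -> B2) (E1 : B1 -> A) (E2 : B2 -> A) :
  graded_rep f1 E1 -> graded_rep f2 E2 ->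
  exists Phi : B1 -> B2, [/\ star_iso Phi, forall k x, Phi (f1 k x) = f2 k x &
    forall x, E2 (Phi x) = E1 x].
Proof.
move=> f1P f2P.
have [Phi [lP nP hP]] := graded_extension f1P f2P.
have [Psi [lQ nQ hQ]] := graded_extension f2P f1P.
have bP := badd_iso lP nP; have bQ := badd_iso lQ nQ.
have PQ y : Phi (Psi y) = y.
  by apply: (graded_eq f2P (badd_comp bP bQ) (badd_id _)) => k x /=; rewrite hQ hP.
have PM a b : Phi (a ** b) = Phi a ** Phi b.
  apply: (graded_eq f1P (badd_comp bP (badd_cmulr b))
    (badd_comp (badd_cmulr (Phi b)) bP)) => k x /=.
  apply: (graded_eq f1P (badd_comp bP (badd_cmull (f1 k x)))
    (badd_comp (badd_cmull (Phi (f1 k x))) bP)) => l y /=.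
  by rewrite -(gr_mul f1P _ _ erefl) !hP (gr_mul f2P _ _ erefl).
exists Phi; split=> //.
- split=> [|b]; last by exists (Psi b).
  split=> //; split=> //.
    (* [graded_rep] does not mention the unit. $\Phi(1)$ is a left unit on the range of [Phi], which
       contains the unit of [B2]. *)
    by have := PM cone (Psi cone); rewrite cmul1l PQ cmul1r => <-.
  apply: (graded_eq f1P (badd_comp bP (badd_cadj _)) (badd_comp (badd_cadj _) bP)) => k x /=.
  by rewrite hP -(gr_star f1P _ erefl) -(gr_star f2P _ erefl) hP.
- apply: (graded_eq f1P (badd_comp (gr_E f2P) bP) (gr_E f1P)) => k x /=.
  rewrite hP; have [k0|k0] := eqVneq k 0; last by rewrite (gr_Ek f1P) ?(gr_Ek f2P) //; apply/eqP.
  by subst k; rewrite (gr_E0 f1P) (gr_E0 f2P).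
Qed.

End Iso.

(** * The crossed product *)

Section CSide.
Variables (R : realType) (D : cstarAlg R) (X : corr D D) (P : tensor_powers X).
Variables (O : cuntz_pimsner P) (A : cstarAlg R) (i : A -> O) (Dk : dbimod i).
Variables (f0 : forall k, Dk k -> O) (E0 : O -> A).
Hypothesis f0P : graded_rep f0 E0.
Arguments f0 : clear implicits.
Variables (F : utensor_functor A) (w : forall k : int, Dk k -> F (zsimple k)).
Arguments w : clear implicits.
Hypothesis (FP : functor_determined_by w).
Variables (C : crossed_product F).

Lemma gr_eq0 k (x : Dk k) : f0 k x = 0 -> x = 0.
Proof.
move=> h; apply: ip_eq0; rewrite -(gr_E_adj f0P) h (linear_zero (cmul_linr _)).
exact: badd0 (gr_E f0P).
Qed.

(** For $y=u^*$, the map [f0] turns $u\circ u^*=0$ into the vanishing of a product $vv^*$ in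
    $\mathcal{O}_X$, and the C*-identity applies there. *)
Lemma dcomp_nondegenerate k l (u : Dk l) : l = - k ->
  (forall y : Dk k, Defs.dcomp 0 u y = 0) -> u = 0.
Proof.
move=> e h; apply: gr_eq0; have ek : k = - l by rewrite e opprK.
have := h (dstar k u); move/(congr1 (f0 0)).
rewrite (gr_mul f0P); last by rewrite ek subrr.
rewrite (badd0 (gr_badd f0P _)) (gr_star f0P) // => h0.
apply/eqP; rewrite -normr_eq0 -cnorm_adj -sqrf_eq0 -cnorm_cstar cadjK h0.
by rewrite normr0.
Qed.

Lemma w_iso k : corr_iso (w k). Proof. by have [h _ _] := FP; apply: h. Qed.

Lemma w_lin k : linear (w k). Proof. by have [[]] := w_iso k. Qed.

Lemma w_ip k x y : ip (w k x) (w k y) = ip x y.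
Proof. by have [_ _ h _] := w_iso k; apply: h. Qed.

Lemma w_norm k x : `|w k x| = `|x|.
Proof. exact: isometry_norm (@w_ip k) x. Qed.

Lemma w_surj k y : exists x, w k x = y.
Proof. by have [_ _ _ h] := w_iso k; apply: h. Qed.

Lemma w_ract k x a : w k (ract x a) = ract (w k x) a.
Proof. by have [[_ h] _ _ _] := w_iso k; apply: h. Qed.

Lemma w_lact k a x : w k (lact a x) = lact a (w k x).
Proof. by have [_ h _ _] := w_iso k; apply: h. Qed.

Lemma w_mul k l m x y : k + l = m -> fmul m (w k x) (w l y) = w m (Defs.dcomp m x y).
Proof. by have [_ h _] := FP; apply: h. Qed.

Lemma w_unit x : Fu F (did x) = w 0 x.
Proof. by have [_ _ h] := FP; apply: h. Qed.

Lemma fmul_lact k a (x : F (zsimple k)) : fmul k (Fu F a) x = lact a x.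
Proof.
have [a' <-] := did_surj Dk a; have [y <-] := w_surj x.
by rewrite w_unit w_mul ?add0r // -dk_lact w_lact.
Qed.

Lemma fmul_ract k a (x : F (zsimple k)) : fmul k x (Fu F a) = ract x a.
Proof.
have [a' <-] := did_surj Dk a; have [y <-] := w_surj x.
by rewrite w_unit w_mul ?addr0 // -dk_ract w_ract.
Qed.

(** Contractivity of the left action is inherited from that of composition in the $(k)D$. *)
Lemma norm_lact_F k a (x : F (zsimple k)) : `|lact a x| <= `|a| * `|x|.
Proof.
have [a' <-] := did_surj Dk a; have [y <-] := w_surj x.
rewrite -w_lact !w_norm dk_lact did_norm; apply: dcomp_norm.
by rewrite add0r.
Qed.

Lemma Fu_lact a b : Fu F (a ** b) = lact a (Fu F b).
Proof. by have [_ h _ _] := Fu_iso F; apply: h. Qed.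

Lemma Fu_lin : linear (Fu F).
Proof. by have [[h _] _ _ _] := Fu_iso F; apply: h. Qed.

Lemma Fu_ip a b : ip (Fu F a) (Fu F b) = cadj a ** b.
Proof. by have [_ _ h _] := Fu_iso F; apply: h. Qed.

(** Both sides solve $\xi^*\cdot\eta=\langle\xi|\eta\rangle$ for all $\eta$, and nondegeneracy of
    the composition leaves a single solution. *)
Lemma cp_adj_w k x : cp_adj C (w k x) = w (- k) (dstar (- k) x).
Proof.
have [u hu] := w_surj (cp_adj C (w k x)); rewrite -hu; congr (w _ _).
apply/eqP; rewrite -subr_eq0; apply/eqP; apply: (@dcomp_nondegenerate k) => // y.
rewrite (linear_sub (dcomp_linl y (addNr k))); apply/eqP; rewrite subr_eq0; apply/eqP.
have winj (a b : Dk 0) : w 0 a = w 0 b -> a = b.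
  move=> e; apply/eqP; rewrite -subr_eq0 -normr_eq0 -w_norm (linear_sub (@w_lin 0)).
  by rewrite e subrr normr0.
apply: winj; rewrite -!w_mul ?addNr // hu cp_adjP w_ip dk_ip w_unit.
by rewrite w_mul ?addNr.
Qed.

Let f k (x : Dk k) : C := cp_in C (w k x).
Arguments f : clear implicits.

Lemma cp_graded_mul k l m x y : k + l = m -> f m (Defs.dcomp m x y) = f k x ** f l y.
Proof. by move=> e; rewrite /f -(w_mul _ _ e) (@cp_in_mul _ _ _ C _ _ _ _ _ e). Qed.

Lemma cp_graded_star k l x : l = - k -> f l (dstar l x) = cadj (f k x).
Proof. by move=> e; subst l; rewrite /f cp_in_adj cp_adj_w. Qed.

Lemma cp_graded_lin k : linear (f k).
Proof. by move=> c x y; rewrite /f w_lin cp_in_lin. Qed.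

Lemma cp_graded0 x : f 0 x = cp_incl C (did x).
Proof. by rewrite /f /cp_incl w_unit. Qed.

Lemma cp_incl_lin : linear (cp_incl C).
Proof. by move=> c x y; rewrite /cp_incl Fu_lin cp_in_lin. Qed.

Lemma cp_incl_mul a b : cp_incl C (a ** b) = cp_incl C a ** cp_incl C b.
Proof.
by rewrite /cp_incl (@cp_in_mul _ _ _ C 0 0 0) ?addr0 // fmul_lact Fu_lact.
Qed.

Lemma cp_incl_adj a : cp_incl C (cadj a) = cadj (cp_incl C a).
Proof.
have [x <-] := did_surj Dk a.
have e0 : 0 = - 0 :> int by rewrite oppr0.
by rewrite -did_adj -!cp_graded0 (cp_graded_star _ e0).
Qed.

Let sums := [set h | exists k (x : F (zsimple k)), h = cp_sum C x].

Lemma cp_sum_dense : dense (lspan sums).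
Proof. by have [_ _ _ h] := cp_sumP C. Qed.

Lemma cp_sum_lin k : linear (@cp_sum _ _ _ C k).
Proof. by have [h _ _ _] := cp_sumP C; case: (h k). Qed.

Lemma cp_sum_ip k (x y : F (zsimple k)) : ip (cp_sum C x) (cp_sum C y) = ip x y.
Proof. by have [_ h _ _] := cp_sumP C; apply: h. Qed.

Lemma cp_sum_orth k l (x : F (zsimple k)) (y : F (zsimple l)) :
  k <> l -> ip (cp_sum C x) (cp_sum C y) = 0.
Proof. by have [_ _ h _] := cp_sumP C; apply: h. Qed.

Lemma cp_sum_norm k (x : F (zsimple k)) : `|cp_sum C x| = `|x|.
Proof. exact: isometry_norm (@cp_sum_ip k) x. Qed.

Lemma cp_rep_badd c : badd (@cp_rep _ _ _ C c).
Proof.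
have [[c0 h] _] := cp_rep_norm c; apply: badd_lin _ c0 h.
case: (@adj_rlinear _ _ _ _ (@cp_rep _ _ _ C c)) => //.
by exists (cp_rep (cadj c)); apply: cp_rep_adj.
Qed.

Lemma cp_rep_baddl h : badd (fun c : C => cp_rep c h).
Proof.
apply: (badd_lin (cp_rep_lin h) (normr_ge0 h)) => c.
by have [[_ hc] _] := cp_rep_norm c; rewrite mulrC.
Qed.

Lemma cp_rep_incl a k (x : F (zsimple k)) :
  cp_rep (cp_incl C a) (cp_sum C x) = cp_sum C (lact a x).
Proof. by rewrite (@cp_rep_in _ _ _ C 0 k k) ?add0r // fmul_lact. Qed.

Lemma cp_rep_incl_bound h : lspan sums h ->
  exists2 S : R[i], 0 <= S & forall a, `|cp_rep (cp_incl C a) h| <= S * `|a|.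
Proof.
move=> [n [c [v [Sv ->]]]].
exists (\sum_(j < n) `|c j| * `|v j|); first by apply: sumr_ge0 => j _; rewrite mulr_ge0.
move=> a; rewrite (badd_sum _ (cp_rep_badd _)) (le_trans (ler_norm_sum _ _ _)) //.
rewrite mulr_suml; apply: ler_sum => j _; have [k [x ->]] := Sv j.
rewrite -(linear_scale _ _ (@cp_sum_lin k)) cp_rep_incl !cp_sum_norm -normrZ.
by rewrite mulrC norm_lact_F.
Qed.

(* On a finite sum h the action of a is bounded by some S |a| with S depending
   on h; iterating |T h|^2 <= 6 |h| |T^* T h| removes that dependence. *)
Lemma cp_incl_bound a : `|cp_incl C a| <= 6%:R * `|a|.
Proof.
have [_] := cp_rep_norm (cp_incl C a); apply; split; first exact: mulr_ge0.
apply: (badd_le_dense (cp_rep_badd _) _ cp_sum_dense) => [|h /cp_rep_incl_bound [S S0 hS]].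
  exact: mulr_ge0.
have [->|h0] := eqVneq h 0; first by rewrite (badd0 (cp_rep_badd _)) !normr0 mulr0.
pose M := 6%:R * `|h|.
have M0 : 0 < M by rewrite mulr_gt0 ?normr_gt0.
pose p j := `|cp_rep (cp_incl C (iter j (fun z => cadj z ** z) a)) h|.
have p0 j : 0 <= p j by exact: normr_ge0.
have step j : p j ^+ 2 <= M * p j.+1.
  rewrite /p hm_norm cp_rep_adj -cp_rep_mul -cp_incl_adj -cp_incl_mul.
  exact: ip_bound.
have tower j : M * p 0%N ^+ (2 ^ j) <= M ^+ (2 ^ j) * p j.
  elim: j => [|j IH]; first by rewrite !expr1.
  rewrite -(ler_pM2l M0) expnSr !exprM mulrA -expr2 -exprMn.
  apply: (@le_trans _ _ ((M ^+ (2 ^ j) * p j) ^+ 2)).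
    by rewrite lerXn2r ?nnegrE ?mulr_ge0 ?exprn_ge0 // ltW.
  rewrite exprMn [leRHS]mulrCA; apply: ler_wpM2l; last exact: step.
  by rewrite exprn_ge0 // exprn_ge0 // ltW.
rewrite -[cp_incl C a]/(cp_incl C (iter 0 (fun z => cadj z ** z) a)) -/(p 0%N).
rewrite mulrAC -/M.
(* The tower gives $p_0^{2^j}\le(S/M)(M|a|)^{2^j}$; the further factor $2^j$ allowed by the lemma is
   slack. *)
apply: (@le_of_sqr_towerC _ _ _ (S / M)).
- exact: p0.
- by rewrite mulr_ge0 // ltW.
- by rewrite divr_ge0 // ltW.
move=> j; rewrite -(ler_pM2l M0) (le_trans (tower j)) //.
have := hS (iter j (fun z => cadj z ** z) a); rewrite norm_iter_sq -/(p j) => h1.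
apply: le_trans (ler_wpM2l _ h1) _; first by rewrite exprn_ge0 // ltW.
have -> : M * (S / M * (2 ^ j)%:R * (M * `|a|) ^+ (2 ^ j)) =
    (2 ^ j)%:R * (M ^+ (2 ^ j) * (S * `|a| ^+ (2 ^ j))).
  by rewrite exprMn; field; rewrite gt_eqF.
rewrite ler_peMl ?ler1n ?expn_gt0 // mulr_ge0 ?exprn_ge0 ?(ltW M0) //.
by rewrite mulr_ge0 ?exprn_ge0.
Qed.

(** By the C*-identity $|f(x)|^2$ is the norm of the image of $\langle x|x\rangle$, at most
    $6|x|^2\le36|x|^2$. Uniformity in [k] is what matters; the comparison of norms removes the
    constant. *)
Lemma cp_graded_bound k x : `|f k x| <= 6%:R * `|x|.
Proof.
rewrite -ler_sqr ?nnegrE ?mulr_ge0 // -cnorm_cstar -(cp_graded_star x erefl).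
rewrite -(cp_graded_mul _ _ (addNr k)) cp_graded0 -dk_ip (le_trans (cp_incl_bound _)) //.
by rewrite -hm_norm exprMn ler_wpM2r ?exprn_ge0 // -natrX ler_nat.
Qed.

Lemma cp_graded_rep (E' : C -> A) : is_cp_expectation E' -> graded_rep f E'.
Proof.
move=> [lE cE E'i E'0]; split.
- exact: cp_graded_lin.
- by exists 6%:R => //; apply: cp_graded_bound.
- exact: cp_graded_mul.
- exact: cp_graded_star.
- have -> : [set b | exists k x, b = f k x] = [set c | exists k x, c = @cp_in _ _ _ C k x].
    apply/seteqP; split=> [_ [k [x ->]]|_ [k [x ->]]]; first by exists k, (w k x).
    by have [y <-] := w_surj x; exists k, y.
  exact: cp_in_dense.
- exact: badd_continuous.
- by move=> x; rewrite cp_graded0 E'i.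
- by move=> k x k0; apply: E'0.
Qed.

(** A homogeneous element moves the vacuum into the summand of its own degree, orthogonal to the
    vacuum unless that degree is 0. *)
Lemma cp_vacuum c (E' : C -> A) : is_cp_expectation E' ->
  E' c = ip (cp_sum C (Fu F cone)) (cp_rep c (cp_sum C (Fu F cone))).
Proof.
move=> E'P; have fP := cp_graded_rep E'P.
refine (graded_eq fP (gr_E fP) (badd_comp (badd_ipr _) (cp_rep_baddl _)) _ c) => k x /=.
rewrite {2}/f (@cp_rep_in _ _ _ C k 0 k) ?addr0 // fmul_ract ract1.
have [k0|/eqP k0] := eqVneq k 0; last first.
  by rewrite (gr_Ek fP) // cp_sum_orth // => /esym.
by subst k; rewrite (gr_E0 fP) cp_sum_ip -w_unit Fu_ip cadj1 cmul1l.
Qed.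

Lemma cp_E_bimod (E' : C -> A) a c b : is_cp_expectation E' ->
  E' (cp_incl C a ** b ** cp_incl C c) = a ** E' b ** c.
Proof.
move=> E'P; have fP := cp_graded_rep E'P.
have [a' <-] := did_surj Dk a; have [c' <-] := did_surj Dk c.
rewrite -!cp_graded0.
refine (graded_eq fP (badd_comp (gr_E fP) (badd_comp (badd_cmulr _) (badd_cmull _)))
  (badd_comp (badd_comp (badd_cmulr _) (badd_cmull _)) (gr_E fP)) _ b) => k x /=.
rewrite -(cp_graded_mul _ _ (add0r k)) -(cp_graded_mul _ _ (addr0 k)).
have [k0|/eqP k0] := eqVneq k 0; last first.
  by rewrite !(gr_Ek fP) // (linear_zero (cmul_linr _)) (linear_zero (cmul_linl _)).
by subst k; rewrite !(gr_E0 fP) !did_mul.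
Qed.

(** Conjugation by a homogeneous element preserves degrees, so the degree 0 part of the result comes
    from that of [z]. This spreads $E'(b^*b)=0$ from the vacuum to all homogeneous vectors. *)
Lemma cp_E_conj (E' : C -> A) k (x : Dk k) z : is_cp_expectation E' ->
  E' (cadj (f k x) ** z ** f k x) = E' (cadj (f k x) ** cp_incl C (E' z) ** f k x).
Proof.
move=> E'P; have fP := cp_graded_rep E'P.
have bincl : badd (cp_incl C) by apply: (badd_lin cp_incl_lin _ cp_incl_bound).
have bc := badd_comp (gr_E fP) (badd_comp (badd_cmulr (f k x)) (badd_cmull (cadj (f k x)))).
refine (graded_eq fP bc (badd_comp bc (badd_comp bincl (gr_E fP))) _ z) => l y /=.
have [l0|/eqP l0] := eqVneq l 0; last first.
  rewrite (gr_Ek fP y) // (badd0 bincl) (linear_zero (cmul_linr _)) (linear_zero (cmul_linl _)).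
  rewrite (badd0 (gr_E fP)) -(cp_graded_star x erefl).
  rewrite -(cp_graded_mul _ _ erefl) -(cp_graded_mul _ _ erefl).
  by rewrite (gr_Ek fP) // addrAC addNr add0r.
by subst l; rewrite (gr_E0 fP) cp_graded0.
Qed.

Lemma cp_faithful_expectation (E' : C -> A) : is_cp_expectation E' ->
  faithful_expectation (cp_incl C) E'.
Proof.
move=> E'P; have fP := cp_graded_rep E'P; case: (E'P) => lE _ E'i _.
split=> // [a b c|b|b]; first exact: cp_E_bimod.
  by rewrite (cp_vacuum _ E'P) cp_rep_mul -cp_rep_adj; apply: ip_pos.
move=> b0.
have rep0 h : cp_rep b h = 0.
  refine (badd_eq0_dense (cp_rep_badd b) cp_sum_dense _ h) => _ [n [c [v [Sv ->]]]].
  rewrite (badd_sum _ (cp_rep_badd b)) big1 // => j _.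
  have [k [y ->]] := Sv j; rewrite -(linear_scale _ _ (@cp_sum_lin k)).
  have [x <-] := w_surj (c j *: y).
  (* Every homogeneous vector is $f(x)\Omega$, so the square of the norm of $bf(x)\Omega$ is that of
     $E'(f(x)^*b^*bf(x))$, which vanishes with $E'(b^*b)$. *)
  have -> : cp_sum C (w k x) = cp_rep (f k x) (cp_sum C (Fu F cone)).
    by rewrite {1}/f (@cp_rep_in _ _ _ C k 0 k) ?addr0 // fmul_ract ract1.
  apply: ip_eq0; rewrite -cp_rep_mul cp_rep_adj -cp_rep_mul -(cp_vacuum _ E'P) cadjM.
  rewrite cmulA -(cmulA (cadj (f k x))) cp_E_conj // b0 (linear_zero cp_incl_lin).
  by rewrite (linear_zero (cmul_linr _)) (linear_zero (cmul_linl _)) (linear_zero lE).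
apply/eqP; rewrite -normr_eq0 eq_le normr_ge0 andbT.
have [_] := cp_rep_norm b; apply; split=> // h.
by rewrite rep0 normr0 mul0r.
Qed.

End CSide.

(** * Discreteness *)

Section FunctorSums.
Variables (R : realType) (A : cstarAlg R) (F : utensor_functor A).

Lemma zhom0 V W : @zhom R V W (fun _ _ => 0).
Proof. by move=> v w; rewrite eqxx. Qed.

Lemma F1_zero V W (x : F V) : F1 F (fun (_ : zI V) (_ : zI W) => 0) x = 0.
Proof.
have := @F1_lin _ _ F V W 1 _ _ x (@zhom0 V W) (@zhom0 V W).
have -> : (fun (v : zI V) (u : zI W) => 1 * 0 + 0 : R[i]) = fun _ _ => 0.
  by apply/funext => v; apply/funext => u; rewrite mulr0 addr0.
by rewrite scale1r => /eqP; rewrite -subr_eq0 opprD addrA subrr add0r oppr_eq0 => /eqP.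
Qed.

Lemma F1_sum V W (I : finType) (M : I -> zmat R V W) (x : F V) :
  (forall j, zhom (M j)) ->
  F1 F (fun v u => \sum_j M j v u) x = \sum_j F1 F (M j) x.
Proof.
move=> hM.
(* Degree preservation of the partial sums is carried along the induction, since [F1_lin] asks for
   it. *)
suff [_ h] : zhom (fun v u => \sum_(j <- index_enum I) M j v u) /\
   F1 F (fun v u => \sum_(j <- index_enum I) M j v u) x =
   \sum_(j <- index_enum I) F1 F (M j) x by [].
elim: (index_enum I) => [|j s [zs IH]].
  have -> : (fun (v : zI V) (u : zI W) => \sum_(j <- [::]) M j v u) = fun _ _ => 0.
    by apply/funext => v; apply/funext => u; rewrite big_nil.
  by rewrite F1_zero big_nil; split=> //; apply: zhom0.
have e : (fun v u => \sum_(j <- j :: s) M j v u) =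
    (fun v u => 1 * M j v u + \sum_(j <- s) M j v u).
  by apply/funext => v; apply/funext => u; rewrite big_cons mul1r.
split; last by rewrite e (F1_lin _ _ (hM j) zs) IH big_cons scale1r.
move=> v u; rewrite big_cons.
have [-> h|n0 _] := eqVneq (M j v u) 0; last exact: hM n0.
by apply: zs; rewrite add0r in h.
Qed.

Variable n : nat.

Definition zdegrees : zhilb := @Zhilb 'I_(n.*2.+1) (fun j => degs n j).

Definition zinj (j : 'I_(n.*2.+1)) : zmat R (zsimple (degs n j)) zdegrees :=
  fun _ v => (v == j)%:R.
Arguments zinj : clear implicits.

Lemma zhom_inj j : zhom (zinj j).
Proof.
move=> v u; rewrite /zinj; have [-> //|] := eqVneq u j.
by rewrite eqxx.
Qed.

Lemma zhom_adj V W (M : zmat R V W) : zhom M -> zhom (zmat_adj M).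
Proof. by move=> h v u; rewrite /zmat_adj conjC_eq0 => /h. Qed.

Definition zprj (j : 'I_(n.*2.+1)) (x : F zdegrees) : F (zsimple (degs n j)) :=
  F1 F (zmat_adj (zinj j)) x.

Lemma prj_rlinear j : rlinear (zprj j).
Proof. by apply: F1_rlin; apply: zhom_adj; apply: zhom_inj. Qed.

Lemma prj_lact j a x : zprj j (lact a x) = lact a (zprj j x).
Proof. by apply: F1_lact; apply: zhom_adj; apply: zhom_inj. Qed.

Lemma prj_adj j : is_adj (F1 F (zinj j)) (zprj j).
Proof. by apply: F1_adj; apply: zhom_inj. Qed.

Lemma prj_inj (j : 'I_(n.*2.+1)) (x : F (zsimple (degs n j))) : zprj j (F1 F (zinj j) x) = x.
Proof.
rewrite /zprj -F1_comp; [|exact: zhom_adj (zhom_inj (j := j))|exact: zhom_inj].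
rewrite -[RHS](F1_id x); congr (F1 F _ _); apply/funext => -[]; apply/funext => -[].
rewrite /zmat_comp (bigD1 j) //= /zmat_adj /zinj eqxx conjC1 mulr1 big1 ?addr0 //.
by move=> l /negPf ->; rewrite mul0r.
Qed.

Lemma prj_inj0 (j l : 'I_(n.*2.+1)) (x : F (zsimple (degs n j))) : l != j ->
  zprj l (F1 F (zinj j) x) = 0.
Proof.
move=> lj; rewrite /zprj -F1_comp; [|exact: zhom_adj (zhom_inj (j := l))|exact: zhom_inj].
rewrite -[RHS](@F1_zero _ (zsimple (degs n l)) x); congr (F1 F _ _).
apply/funext => -[]; apply/funext => -[].
rewrite /zmat_comp big1 // => m _; rewrite /zmat_adj /zinj.
have [->|_] := eqVneq m j; last by rewrite mul0r.
by rewrite eq_sym (negPf lj) conjC0 mulr0.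
Qed.

(** [F] is applied to $\sum_j|e_j\rangle\langle e_j|=\mathrm{id}$; this splits $F(V)$ into the
    $F(\mathbb{C}_k)$. *)
Lemma prj_sum x : \sum_j F1 F (zinj j) (zprj j x) = x.
Proof.
have zz j : zhom (zmat_comp (zinj j) (zmat_adj (zinj j))).
  move=> v u; rewrite /zmat_comp (bigD1 tt) //= big1 ?addr0; last by case.
  rewrite /zmat_adj /zinj; have [->|_] := eqVneq v j; last by rewrite conjC0 mul0r eqxx.
  by have [->|_] := eqVneq u j; last by rewrite mulr0 eqxx.
under eq_bigr => j _ do
  rewrite /zprj -(F1_comp _ (zhom_inj (j := j)) (zhom_adj (zhom_inj (j := j)))).
rewrite -F1_sum // -[RHS](F1_id x); congr (F1 F _ _).
apply/funext => v; apply/funext => u; rewrite (bigD1 v) //= big1 => [|j jv].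
  rewrite /zmat_comp (bigD1 tt) //= big1 ?addr0; last by case.
  by rewrite /zmat_adj /zinj eqxx conjC1 mul1r /zmat_id eq_sym.
rewrite /zmat_comp big1 // => m _; rewrite /zmat_adj /zinj.
by rewrite eq_sym (negPf jv) conjC0 mul0r.
Qed.

Lemma ip_prj (x y : F zdegrees) : ip x y = \sum_j ip (zprj j x) (zprj j y).
Proof.
rewrite -{1}(prj_sum x) ip_suml; apply: eq_bigr => j _.
exact: prj_adj.
Qed.

End FunctorSums.

Arguments zinj R {n} j.

Section CDiscrete.
Variables (R : realType) (D : cstarAlg R) (X : corr D D) (P : tensor_powers X).
Variables (O : cuntz_pimsner P) (A : cstarAlg R) (i : A -> O) (Dk : dbimod i).
Variables (f0 : forall k, Dk k -> O) (E0 : O -> A).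
Hypothesis f0P : graded_rep f0 E0.
Variables (F : utensor_functor A) (w : forall k : int, Dk k -> F (zsimple k)).
Arguments w : clear implicits.
Hypothesis (FP : functor_determined_by w).
Variables (C : crossed_product F) (E' : C -> A).
Hypothesis E'P : is_cp_expectation E'.

Let f k (x : Dk k) : C := cp_in C (w k x).
Let fP : graded_rep f E' := cp_graded_rep f0P FP E'P.

Lemma cp_in_lact k a (x : F (zsimple k)) : cp_in C (lact a x) = cp_incl C a ** cp_in C x.
Proof. by rewrite /cp_incl (@cp_in_mul _ _ _ C 0 k k) ?add0r // (fmul_lact FP). Qed.

Lemma cp_in_ract k a (x : F (zsimple k)) : cp_in C (ract x a) = cp_in C x ** cp_incl C a.
Proof. by rewrite /cp_incl (@cp_in_mul _ _ _ C k 0 k) ?addr0 // (fmul_ract FP). Qed.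

Lemma cp_in_E k (x y : F (zsimple k)) : E' (cadj (cp_in C x) ** cp_in C y) = ip x y.
Proof.
have [x' <-] := w_surj FP x; have [y' <-] := w_surj FP y.
by rewrite (w_ip FP) -(gr_E_adj fP).
Qed.

Lemma cp_in_E0 k l (x : F (zsimple k)) (y : F (zsimple l)) : l <> k ->
  E' (cadj (cp_in C x) ** cp_in C y) = 0.
Proof.
have [x' <-] := w_surj FP x; have [y' <-] := w_surj FP y.
exact: gr_E_orth fP _ _ _ _.
Qed.

(** The finite direct sum is taken in the graded spaces, before applying [F], so that [F0_fgp]
    supplies the left inner product and both finite bases. *)
Lemma graded_sum_pqn n (c : forall k, Dk k) : pqn (cp_incl C) E' (graded_sum f n c).
Proof.
pose g (y : F (zdegrees n)) : C := \sum_j cp_in C (zprj j y).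
exists (F (zdegrees n)), g; split.
- exact: F0_fgp.
- move=> k x y; rewrite /g scaler_sumr -big_split; apply: eq_bigr => j _ /=.
  by have [lp _] := prj_rlinear F j; rewrite lp cp_in_lin.
- split=> a y; rewrite /g.
    rewrite (linear_bigsum _ (cmul_linr _)); apply: eq_bigr => j _.
    by rewrite prj_lact cp_in_lact.
  rewrite (linear_bigsum _ (cmul_linl _)); apply: eq_bigr => j _.
  by have [_ rp] := prj_rlinear F j; rewrite rp cp_in_ract.
- move=> x y; rewrite ip_prj /g (badd_sum _ (badd_cadj _)).
  rewrite (linear_bigsum _ (cmul_linl _)) (badd_sum _ (gr_E fP)); apply: eq_bigr => j _.
  rewrite (linear_bigsum _ (cmul_linr _)) (badd_sum _ (gr_E fP)) (bigD1 j) //= cp_in_E.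
  rewrite big1 ?addr0 // => l lj; rewrite cp_in_E0 // => /degs_inj /val_inj /eqP.
  by apply/negP.
- exists (\sum_j F1 F (zinj R j) (w _ (c (degs n j)))) => //.
  rewrite /g /graded_sum; apply: eq_bigr => j _; congr (cp_in C _).
  rewrite (rlinear_sum _ (prj_rlinear F j)) (bigD1 j) //= prj_inj big1 ?addr0 // => l lj.
  by rewrite prj_inj0 // eq_sym.
Qed.

Lemma cp_pqn_dense : dense (pqn (cp_incl C) E').
Proof.
apply/dense_normP => x e e0; have [y Sy le] := (dense_normP _).1 (gr_dense fP) x e e0.
exists y => //; have [_ [n [c [-> _]]]] := lspan_graded_rel fP fP Sy.
exact: graded_sum_pqn.
Qed.

Lemma cp_incl_star_hom : star_hom (cp_incl C).
Proof.
split; [exact: cp_incl_lin|exact: (cp_incl_mul FP)|exact: cp_in_one|].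
exact: (cp_incl_adj f0P FP).
Qed.

(** Isometry of the inclusion is left as a hypothesis: inside the crossed product only the bound
    with constant 6 has been proved, and the comparison with $\mathcal{O}_X$ gives the rest. *)
Lemma cp_discrete : (forall a, `|cp_incl C a| = `|a|) -> cstar_discrete (cp_incl C) E'.
Proof.
move=> h; split; [split=> //; exact: cp_incl_star_hom| |exact: cp_pqn_dense].
exact: (cp_faithful_expectation f0P FP).
Qed.

End CDiscrete.

(** * Transport along the isomorphism and conclusion *)

(** Sub-bimodules of [B2] are pulled back along a pointwise inverse [Psi]; injectivity of [Phi]
    reduces each algebraic identity for [Psi] to one that holds in [B2]. *)
Lemma cstar_discrete_iso (R : realType) (A B1 B2 : cstarAlg R) (i1 : A -> B1)
    (i2 : A -> B2) (E1 : B1 -> A) (E2 : B2 -> A) (Phi : B1 -> B2) :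
  star_iso Phi -> (forall a, Phi (i1 a) = i2 a) -> (forall x, E2 (Phi x) = E1 x) ->
  star_embedding i1 -> cstar_discrete i2 E2 -> cstar_discrete i1 E1.
Proof.
move=> [[[lP mP oP aP] nP] sP] Pi PE i1P [_ [lE Ei Eb Ep Ef] dE].
have inj x y : Phi x = Phi y -> x = y.
  move=> e; apply/eqP; rewrite -subr_eq0 -normr_eq0 -nP (linear_sub lP) e.
  by rewrite subrr normr0.
have /choice[Psi hPsi] := sP.
split=> //.
- split=> [k x y|a|a b c|b|b].
  + by rewrite -!PE lP lE.
  + by rewrite -PE Pi Ei.
  + by rewrite -!PE !mP !Pi Eb.
  + by rewrite -PE mP aP; apply: Ep.
  + rewrite -PE mP aP => /Ef h; apply: inj.
    by rewrite h (linear_zero lP).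
- apply/dense_normP => x e e0; have [y yp le] := (dense_normP _).1 dE (Phi x) e e0.
  exists (Psi y); last by rewrite -nP (linear_sub lP) hPsi.
  case: yp => Y [f [Yf lf [fl fr] fip [u _ fu]]]; exists Y, (Psi \o f); split=> //.
  + by move=> k a b; apply: inj; rewrite /= lP !hPsi lf.
  + split=> a b; apply: inj; rewrite /= mP !hPsi Pi //.
  + by move=> a b; rewrite fip /= -PE mP aP !hPsi.
  + by exists u => //=; rewrite fu.
Qed.

Theorem corollary2p8 (R : realType) (D : cstarAlg R) (X : corr D D)
    (X_fgp : bim_fgp X) (X_full : full X) (X_faithful : faithful X)
    (P : tensor_powers X) (O : cuntz_pimsner P)
    (gamma : R[i]%C -> O -> O) (gammaP : is_gauge gamma)
    (A : cstarAlg R) (i : A -> O) (iP : is_fixed_algebra gamma i)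
    (E : O -> A) (EP : is_gauge_expectation gamma i E)
    (Dk : dbimod i)
    (F : utensor_functor A) (w : forall k : int, Dk k -> F (zsimple k))
    (FP : functor_determined_by w)
    (C : crossed_product F) (E' : C -> A) (E'P : is_cp_expectation E') :
  cstar_discrete i E /\ cstar_discrete (cp_incl C) E' /\
  exists Phi : O -> C,
    star_iso Phi /\
    (forall a : A, Phi (i a) = cp_incl C a) /\
    (forall x : O, E' (Phi x) = E x).
Proof.
have bX : rbasis X.
  by have [lip [_ _ _ _ [[n [u hu]] _]]] := X_fgp; exists 'I_n, u.
have [f0 [f0P f00]] := ox_graded_rep Dk gammaP bX iP EP.
have fP := cp_graded_rep f0P FP E'P.
have [Phi [iPhi hPhi EPhi]] := graded_iso f0P fP.
have Phii a : Phi (i a) = cp_incl C a.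
  by have [x <-] := did_surj Dk a; rewrite -f00 hPhi (cp_graded0 FP).
(* $\Phi\circ i$ is a composite of isometries, which sharpens the bound with constant 6. *)
have nC a : `|cp_incl C a| = `|a|.
  by case: (iPhi) => [[_ nPhi] _]; rewrite -Phii nPhi (incl_norm iP).
have dC := cp_discrete f0P FP E'P nC.
split; last by split=> //; exists Phi.
exact: cstar_discrete_iso iPhi Phii EPhi (proj1 iP) dC.
Qed.
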